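(* Assume $(\lambda_1,\dots,\lambda_d)\neq0$ and let $\rho$ be the unique positive real number with $\rho^d|\lambda_d|+\dots+\rho|\lambda_1|=1$. Then the power series $F_\lambda(r)=r+\sum_{k\ge2}v_k(2\pi)r^k$ (the return mapping, in the inverse form) converges at least on the complex disc $D(0,\rho/2)$.
   Context: Let $d\ge1$, let $\lambda=(\lambda_1,\dots,\lambda_d)$ be real parameters, and $p(x)=\sum_{i=1}^d\lambda_i x^i$. Consider the planar Liénard system $\dot x=y$, $\dot y=-x+p(x)y$. In polar coordinates $x=r\cos\theta$, $y=r\sin\theta$ its orbits satisfy $$\frac{dr}{d\theta}=\frac{r\,p(r\cos\theta)\sin^2\theta}{-1+\sin\theta\cos\theta\,p(r\cos\theta)}.$$ For small $r_0$ let $r(\theta;r_0)$ be the solution with $r(0;r_0)=r_0$; for each $\theta$ the inverse of $r_0\mapsto r(\theta;r_0)$ has the expansion $r_0=r+\sum_{k\ge2}v_k(\theta)r^k$, each $v_k(\theta)$ being a polynomial in $\lambda$. At $\theta=2\pi$ this is the inverse of the first return mapping. *)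

(* Defs.v *)
From Stdlib Require Import Reals Arith Factorial.
From Coquelicot Require Import Coquelicot.
Open Scope R_scope.

Definition lpoly (d : nat) (lam : nat -> R) (x : R) : R :=
  sum_n_m (fun i => lam i * x ^ i) 1 d.

Definition polar_den (d : nat) (lam : nat -> R) (t r : R) : R :=
  -1 + sin t * cos t * lpoly d lam (r * cos t).

Definition polar_rhs (d : nat) (lam : nat -> R) (t r : R) : R :=
  r * lpoly d lam (r * cos t) * (sin t) ^ 2 / polar_den d lam t r.

Definition rho_sum (d : nat) (lam : nat -> R) (rho : R) : R :=
  sum_n_m (fun i => rho ^ i * Rabs (lam i)) 1 d.

Definition taylor_coef (f : R -> R) (k : nat) : R :=
  Derive_n f k 0 / INR (Factorial.fact k).

(* Main.v *)
(* Rescaling [x] we may take [rho = 1], i.e. [sum |lambda_i| = 1]. The inverse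
   return map sends [z] to the value at [theta = 0] of the solution with value
   [z] at [theta = 2 pi]. We solve this problem with [z] an indeterminate, in
   the Banach algebra of power series normed by [sum |a_k| 2^(-k)], which gives
   the convergence of the resulting series at once.

   Put [1 / r = 1 / z - w]. Then
     [w' = - sin^2 (p / r) u],  [u = 1 / (1 - sin cos p)],  [p = p (r cos)].
   Absolute values alone are too crude: the term [lambda_1 cos sin^2] of the
   integrand has to be integrated exactly, to [lambda_1 sin^3 / 3]. With
   [a = |lambda_1|], [b = 1 - a], the bounds [|r| <= 5/6], [|w| <= 4/5],
   [|u| <= 3 a / 2 + 4 b / 3] then reproduce themselves; [|w| <= 4/5] implies
   [|r| <= 1 / (2 - 4/5) = 5/6] because [z] has norm [1/2]. Every equation has
   the form constant + [z] * (...), so the Picard iterates stabilise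
   coefficientwise, and the bounds pass to the limit. Evaluation at a small real
   [x] solves the polar equation, and uniqueness identifies it with [inv]. *)

Require Import Defs.
From Stdlib Require Import Reals Lra Lia Machin.
From Coquelicot Require Import Coquelicot.
Open Scope R_scope.

(** * Power series normed by [sum |a k| / 2 ^ k] *)

(** Bounds on all partial sums express [sum |a k| / 2 ^ k <= M] without convergence side conditions.
    Each inequality involves finitely many coefficients, so a coefficientwise limit inherits the
    bound. *)
Definition bounded_by (a : nat -> R) (M : R) : Prop :=
  forall N, sum_f_R0 (fun k => Rabs (a k) * (/ 2) ^ k) N <= M.

Definition PS_const (c : R) (n : nat) : R :=
  match n with 0%nat => c | S _ => 0 end.

Lemma half_pow_pos (k : nat) : 0 < (/ 2) ^ k.
Proof. apply pow_lt; lra. Qed.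

Lemma bounded_by_ge0 (a : nat -> R) (M : R) : bounded_by a M -> 0 <= M.
Proof.
  intros H. apply Rle_trans with (2 := H 0%nat). simpl.
  pose proof (Rabs_pos (a 0%nat)). lra.
Qed.

Lemma bounded_by_le (a : nat -> R) (M M' : R) :
  bounded_by a M -> M <= M' -> bounded_by a M'.
Proof. intros H HM N. apply Rle_trans with (2 := HM). apply H. Qed.

Lemma bounded_by_plus (a b : nat -> R) (M M' : R) :
  bounded_by a M -> bounded_by b M' -> bounded_by (PS_plus a b) (M + M').
Proof.
  intros Ha Hb N.
  apply Rle_trans with (2 := Rplus_le_compat _ _ _ _ (Ha N) (Hb N)).
  rewrite <- sum_plus. apply sum_Rle. intros n _.
  rewrite <- Rmult_plus_distr_r. apply Rmult_le_compat_r.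
  - apply Rlt_le, half_pow_pos.
  - apply Rabs_triang.
Qed.

Lemma bounded_by_scal (c : R) (a : nat -> R) (M : R) :
  bounded_by a M -> bounded_by (PS_scal c a) (Rabs c * M).
Proof.
  intros Ha N.
  apply Rle_trans with (2 := Rmult_le_compat_l _ _ _ (Rabs_pos c) (Ha N)).
  rewrite scal_sum. apply sum_Rle. intros n _.
  change (PS_scal c a n) with (c * a n). rewrite Rabs_mult.
  apply Req_le. ring.
Qed.

Lemma bounded_by_const (c : R) : bounded_by (PS_const c) (Rabs c).
Proof.
  intros N. apply Req_le. induction N as [|N IH]; simpl.
  - ring.
  - simpl in IH. rewrite IH, Rabs_R0. ring.
Qed.

(** Multiplication by the indeterminate halves the norm; the divisions by 2 in the later numerical
    inequalities come from here. *)
Lemma bounded_by_incr (a : nat -> R) (M : R) :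
  bounded_by a M -> bounded_by (PS_incr_1 a) (M / 2).
Proof.
  intros Ha.
  assert (H0 : Rabs (PS_incr_1 a 0) * (/ 2) ^ 0 = 0).
  { change (PS_incr_1 a 0) with 0. rewrite Rabs_R0. ring. }
  intros [|N].
  - change (Rabs (PS_incr_1 a 0) * (/ 2) ^ 0 <= M / 2). rewrite H0.
    pose proof (bounded_by_ge0 _ _ Ha). lra.
  - rewrite decomp_sum by lia. rewrite H0, Rplus_0_l.
    apply Rle_trans with (/ 2 * sum_f_R0 (fun k => Rabs (a k) * (/ 2) ^ k) N).
    + rewrite scal_sum. apply Req_le.
      apply sum_eq. intros i _. change (PS_incr_1 a (S i)) with (a i). simpl. ring.
    + specialize (Ha N). lra.
Qed.

Lemma sum_PS_mult (a b : nat -> R) (N : nat) :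
  sum_f_R0 (PS_mult a b) N
  = sum_f_R0 (fun i => a i * sum_f_R0 b (N - i)) N.
Proof.
  induction N as [|N IH].
  - reflexivity.
  - change (sum_f_R0 (PS_mult a b) (S N))
      with (sum_f_R0 (PS_mult a b) N + PS_mult a b (S N)).
    rewrite IH. unfold PS_mult. simpl. rewrite Nat.sub_diag. simpl.
    rewrite <- Rplus_assoc, <- sum_plus. f_equal.
    apply sum_eq. intros i Hi.
    replace (match i with 0%nat => S N | S l => (N - l)%nat end)
      with (S (N - i)) by (destruct i; lia).
    simpl. ring.
Qed.

(** The weights are multiplicative, so the weighted absolute values are compared with their own
    Cauchy product. Grouped by the first index, its partial sum is at most [M'] times a partial sum
    of the first factor. *)
Lemma bounded_by_mult (a b : nat -> R) (M M' : R) :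
  bounded_by a M -> bounded_by b M' -> bounded_by (PS_mult a b) (M * M').
Proof.
  intros Ha Hb N.
  set (a' := fun k => Rabs (a k) * (/ 2) ^ k).
  set (b' := fun k => Rabs (b k) * (/ 2) ^ k).
  assert (Ha' : forall k, 0 <= a' k).
  { intros k. apply Rmult_le_pos; [apply Rabs_pos | apply Rlt_le, half_pow_pos]. }
  apply Rle_trans with (sum_f_R0 (PS_mult a' b') N).
  { apply sum_Rle. intros n _. unfold PS_mult.
    apply Rle_trans with
      (sum_f_R0 (fun k => Rabs (a k * b (n - k)%nat)) n * (/ 2) ^ n).
    - apply Rmult_le_compat_r; [apply Rlt_le, half_pow_pos |].
      apply Rsum_abs.
    - rewrite Rmult_comm, scal_sum. apply Req_le, sum_eq. intros i Hi.
      unfold a', b'. rewrite Rabs_mult.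
      replace n with (i + (n - i))%nat at 2 by lia. rewrite pow_add. ring. }
  rewrite sum_PS_mult.
  apply Rle_trans with (M' * sum_f_R0 a' N).
  { rewrite scal_sum. apply sum_Rle. intros i _.
    apply Rmult_le_compat_l; [apply Ha' | apply Hb]. }
  rewrite Rmult_comm. apply Rmult_le_compat_r.
  - exact (bounded_by_ge0 _ _ Hb).
  - apply Ha.
Qed.

Lemma bounded_by_coef (a : nat -> R) (M : R) (k : nat) :
  bounded_by a M -> Rabs (a k) * (/ 2) ^ k <= M.
Proof.
  intros Ha. apply Rle_trans with (2 := Ha k).
  destruct k as [|k]; simpl; [lra |].
  assert (0 <= sum_f_R0 (fun k => Rabs (a k) * (/ 2) ^ k) k).
  { apply cond_pos_sum. intros n.
    apply Rmult_le_pos; [apply Rabs_pos | apply Rlt_le, half_pow_pos]. }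
  lra.
Qed.

Lemma bounded_by_CV_radius (a : nat -> R) (M x : R) :
  bounded_by a M -> Rabs x < / 2 -> Rbar_lt (Rabs x) (CV_radius a).
Proof.
  intros Ha Hx.
  apply Rbar_lt_le_trans with (/ 2); [exact Hx |].
  apply CV_radius_bounded. exists M. intros n.
  rewrite Rabs_mult, (Rabs_pos_eq ((/ 2) ^ n)).
  - apply bounded_by_coef, Ha.
  - apply Rlt_le, half_pow_pos.
Qed.

Lemma bounded_by_ex_pseries (a : nat -> R) (M x : R) :
  bounded_by a M -> Rabs x < / 2 -> ex_pseries a x.
Proof.
  intros Ha Hx. apply CV_radius_inside.
  exact (bounded_by_CV_radius _ _ _ Ha Hx).
Qed.

Lemma PSeries_PS_const (c x : R) : Rabs x < / 2 -> PSeries (PS_const c) x = c.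
Proof.
  intros Hx. rewrite PSeries_decr_1.
  - rewrite (PSeries_ext _ (fun _ => 0)) by (intros n; reflexivity).
    rewrite PSeries_const_0. simpl. ring.
  - exact (bounded_by_ex_pseries _ _ _ (bounded_by_const c) Hx).
Qed.

(** * Termwise integration *)

(** The mean value theorem is applied to [G - f] and [G + f], whose derivatives are nonnegative. The
    order of [x] and [y] is left open because times beyond [2 * PI] occur later. *)
Lemma abs_diff_le_of_derive (f df G g : R -> R) (x y : R) :
  (forall t, Rmin x y <= t <= Rmax x y ->
     is_derive f t (df t) /\ is_derive G t (g t) /\ Rabs (df t) <= g t) ->
  Rabs (f y - f x) <= Rabs (G y - G x).
Proof.
  intros H.
  assert (Hs : forall e, e = 1 \/ e = -1 ->
    exists c, 0 <= c /\ (G y - G x) - e * (f y - f x) = c * (y - x)).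
  { intros e He.
    destruct (MVT_gen (fun t => G t - e * f t) x y (fun t => g t - e * df t))
      as [c [Hc Heq]].
    - intros t Ht. destruct (H t) as [H1 [H2 _]]; [lra |].
      apply (is_derive_minus (V := R_NormedModule)); [exact H2 |].
      apply is_derive_scal. exact H1.
    - intros t Ht. destruct (H t Ht) as [H1 [H2 _]].
      apply continuity_pt_minus.
      + apply continuity_pt_filterlim. apply (ex_derive_continuous (K := R_AbsRing) G).
        eexists; exact H2.
      + apply continuity_pt_scal. apply continuity_pt_filterlim.
        apply (ex_derive_continuous (K := R_AbsRing) f). eexists; exact H1.
    - exists (g c - e * df c). split.
      + destruct (H c Hc) as [_ [_ H3]]. apply Rabs_le_between in H3.
        destruct He; subst e; lra.
      + rewrite <- Heq. ring. }
  destruct (Hs 1) as [c1 [Hc1 H1]]; [now left |].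
  destruct (Hs (-1)) as [c2 [Hc2 H2]]; [now right |].
  destruct (Rle_dec x y) as [Hxy | Hxy].
  - pose proof (Rmult_le_pos _ (y - x) Hc1 ltac:(lra)).
    pose proof (Rmult_le_pos _ (y - x) Hc2 ltac:(lra)).
    rewrite (Rabs_pos_eq (G y - G x)) by lra. apply Rabs_le. lra.
  - pose proof (Rmult_le_pos _ (x - y) Hc1 ltac:(lra)).
    pose proof (Rmult_le_pos _ (x - y) Hc2 ltac:(lra)).
    rewrite (Rabs_left1 (G y - G x)) by lra. apply Rabs_le. lra.
Qed.

Lemma is_derive_RInt_left (f : R -> R) (b t : R) :
  (forall x, continuous f x) ->
  is_derive (fun s => RInt f s b) t (- f t).
Proof.
  intros Hf. apply (is_derive_RInt' (V := R_NormedModule) f (fun s => RInt f s b) t b).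
  - apply filter_forall. intros s.
    apply (RInt_correct (V := R_CompleteNormedModule) f).
    apply (ex_RInt_continuous (V := R_CompleteNormedModule) f). intros; apply Hf.
  - apply Hf.
Qed.

(* The signs [e k] turn the sum of absolute values into one function, to which
   the mean value inequality applies. *)
Lemma bounded_by_RInt (F : R -> nat -> R) (G g : R -> R) (t b : R) :
  (forall k x, continuous (fun s => F s k) x) ->
  (forall s, Rmin t b <= s <= Rmax t b ->
     is_derive G s (g s) /\ bounded_by (F s) (g s)) ->
  bounded_by (fun k => RInt (fun s => F s k) t b) (Rabs (G b - G t)).
Proof.
  intros HF HG N.
  set (e := fun k => (if Rle_dec 0 (RInt (fun s => F s k) t b) then 1 else -1) * (/ 2) ^ k).
  set (f := fun s => sum_n (fun k => e k * RInt (fun s => F s k) s b) N).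
  set (df := fun s => sum_n (fun k => e k * - F s k) N).
  assert (Hf0 : f b = 0).
  { unfold f. rewrite sum_n_Reals. apply sum_eq_R0. intros k _.
    rewrite RInt_point. apply Rmult_0_r. }
  assert (Hft : sum_f_R0 (fun k => Rabs (RInt (fun s => F s k) t b) * (/ 2) ^ k) N = f t).
  { unfold f. rewrite sum_n_Reals. apply sum_eq. intros k _. unfold e.
    destruct (Rle_dec 0 (RInt (fun s => F s k) t b)).
    - rewrite Rabs_pos_eq by assumption. ring.
    - rewrite Rabs_left1 by lra. ring. }
  rewrite Hft.
  apply Rle_trans with (Rabs (f b - f t)).
  { rewrite Hf0. rewrite Rminus_0_l, Rabs_Ropp. apply Rle_abs. }
  apply abs_diff_le_of_derive with df g.
  intros s Hs. destruct (HG s Hs) as [HG1 HG2]. split; [| split].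
  - apply (is_derive_sum_n (K := R_AbsRing) (V := R_NormedModule)
      (fun k x => e k * RInt (fun s => F s k) x b) N s (fun k => e k * - F s k)).
    intros k _. apply is_derive_scal. apply is_derive_RInt_left. apply HF.
  - exact HG1.
  - apply Rle_trans with (2 := HG2 N). unfold df. rewrite sum_n_Reals.
    eapply Rle_trans; [apply Rsum_abs |]. apply sum_Rle. intros k _.
    unfold e. rewrite !Rabs_mult, Rabs_Ropp, (Rabs_pos_eq ((/ 2) ^ k)).
    2: apply Rlt_le, half_pow_pos.
    pose proof (half_pow_pos k). pose proof (Rabs_pos (F s k)).
    destruct (Rle_dec 0 (RInt (fun s => F s k) t b)).
    + rewrite Rabs_R1. lra.
    + rewrite Rabs_left by lra. lra.
Qed.

(** * Trigonometric estimates *)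

(** A partial sum of the alternating series for [2 arctan (1/3) + arctan (1/7) = PI / 4]. The value
    63/20 makes [5 / 3 * PI] at most 21/4. *)
Lemma PI_lt_3_15 : PI < 63 / 20.
Proof.
  destruct (PI_2_3_7_ineq 1) as [_ H].
  unfold tg_alt, PI_2_3_7_tg, Ratan_seq in H. simpl in H. lra.
Qed.

Lemma cos_sqr (t : R) : cos t ^ 2 = 1 - sin t ^ 2.
Proof. pose proof (sin2_cos2 t) as H. unfold Rsqr in H. simpl. lra. Qed.

(** With [s = 23/40], close to the maximiser [1 / sqrt 3] of [x (1 - x^2)], the product [(x - s)^2
    (x + 2 s) = x^3 - 3 s^2 x + 2 s^3] is nonnegative. *)
Lemma abs_sin_cos2_le (t : R) : Rabs (sin t) * cos t ^ 2 <= 2 / 5.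
Proof.
  rewrite cos_sqr, <- (pow2_abs (sin t)).
  pose proof (Rabs_pos (sin t)) as H. revert H.
  generalize (Rabs (sin t)). intros x Hx.
  assert (0 <= (x - 23 / 40) ^ 2 * (x + 46 / 40)).
  { apply Rmult_le_pos; [apply pow2_ge_0 | lra]. }
  nra.
Qed.

(** After squaring, with [x = cos^2], one has to bound [(1 - x) x^3], maximal at [x = 3/4]; the
    nonnegative product below is [x^4 - x^3 + 27/256]. *)
Lemma abs_sin_cos3_le (t : R) : Rabs (sin t) * Rabs (cos t) ^ 3 <= 9 / 25.
Proof.
  assert (H : (Rabs (sin t) * Rabs (cos t) ^ 3) ^ 2 <= (9 / 25) ^ 2).
  { replace ((Rabs (sin t) * Rabs (cos t) ^ 3) ^ 2)
      with (Rabs (sin t) ^ 2 * (Rabs (cos t) ^ 2) ^ 3) by ring.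
    rewrite !pow2_abs.
    pose proof (cos_sqr t) as E. pose proof (pow2_ge_0 (cos t)) as Hc.
    replace (sin t ^ 2) with (1 - cos t ^ 2) by lra.
    revert Hc. generalize (cos t ^ 2). intros x Hx.
    assert (0 <= (x - 3 / 4) ^ 2 * (x * x + x / 2 + 3 / 16)).
    { apply Rmult_le_pos; [apply pow2_ge_0 | nra]. }
    nra. }
  apply Rnot_lt_le. intros Hlt.
  assert ((9 / 25) ^ 2 < (Rabs (sin t) * Rabs (cos t) ^ 3) ^ 2).
  { nra. }
  lra.
Qed.

(* Weighted AM-GM; the weight 3/7 is close to the optimal one. *)
Lemma abs_sin_cos_le (t : R) :
  Rabs (sin t * cos t) <= 3 / 14 + 7 / 6 * (sin t ^ 2 * cos t ^ 2).
Proof.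
  replace (sin t ^ 2 * cos t ^ 2) with (Rabs (sin t * cos t) ^ 2)
    by (rewrite pow2_abs; ring).
  pose proof (pow2_ge_0 (Rabs (sin t * cos t) - 3 / 7)). lra.
Qed.

(* [sc_primij] is an antiderivative of [sin ^ i * cos ^ j]. *)
Definition sc_prim22 (t : R) : R :=
  t / 8 + sin t * cos t * (- / 8 + / 4 * sin t ^ 2).
Definition sc_prim44 (t : R) : R :=
  3 / 128 * t + sin t * cos t *
    (- (3 / 128) - / 64 * sin t ^ 2 + 3 / 16 * sin t ^ 4 - / 8 * sin t ^ 6).
Definition sc_prim24 (t : R) : R :=
  t / 16 + sin t * cos t *
    (- / 16 + 7 / 24 * sin t ^ 2 - / 6 * sin t ^ 4).
Definition sc_prim46 (t : R) : R :=
  3 / 256 * t + sin t * cos t *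
    (- (3 / 256) - / 128 * sin t ^ 2 + 31 / 160 * sin t ^ 4
     - 21 / 80 * sin t ^ 6 + / 10 * sin t ^ 8).

(* Dominates the norm of the integrand of [w], see [bounded_by_w]. *)
Definition maj (a b U t : R) : R :=
  5 / 3 * (sin t ^ 2 * cos t ^ 2) *
  (b + U * (3 / 14 + 7 / 6 * (sin t ^ 2 * cos t ^ 2))
         * (a + 25 / 36 * b * cos t ^ 2)).

Definition maj_prim (a b U t : R) : R :=
  5 / 3 * (b * sc_prim22 t
    + U * (a * (3 / 14 * sc_prim22 t + 7 / 6 * sc_prim44 t)
         + 25 / 36 * b * (3 / 14 * sc_prim24 t + 7 / 6 * sc_prim46 t))).

(** Only even powers of the cosine survive, so replacing [cos^2] by [1 - sin^2] leaves a polynomial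
    identity in the sine. *)
Lemma is_derive_maj_prim (a b U t : R) :
  is_derive (maj_prim a b U) t (maj a b U t).
Proof.
  unfold maj_prim, sc_prim22, sc_prim44, sc_prim24, sc_prim46, maj.
  auto_derive; [trivial |].
  pose proof (cos_sqr t) as E.
  assert (E2 : cos t * cos t = 1 - sin t * sin t) by (simpl in E; lra).
  revert E2. generalize (cos t) (sin t). intros c s E2.
  field_simplify.
  replace (c ^ 6) with ((1 - s * s) ^ 3) by (rewrite <- E2; ring).
  replace (c ^ 4) with ((1 - s * s) ^ 2) by (rewrite <- E2; ring).
  replace (c ^ 2) with (1 - s * s) by (rewrite <- E2; ring).
  field.
Qed.

Lemma sin_cos_sqr_bounds (t : R) :
  0 <= sin t ^ 2 * cos t ^ 2 <= / 4 /\ 0 <= cos t ^ 2 <= 1.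
Proof.
  rewrite cos_sqr. pose proof (cos_sqr t) as E.
  pose proof (pow2_ge_0 (cos t)). pose proof (pow2_ge_0 (sin t)).
  revert E H H0. generalize (sin t ^ 2) (cos t ^ 2). intros x y E Hy Hx.
  pose proof (pow2_ge_0 (x - / 2)). repeat split; nra.
Qed.

(** A crude slope bound: it serves only for the margins of length 1/1000 around [[0, 2 PI]] and for
    the uniform bound on the derivative of [w]. *)
Lemma maj_bounds (a b U t : R) :
  0 <= a -> 0 <= b -> a + b = 1 -> 0 <= U <= 3 / 2 -> 0 <= maj a b U t <= 5.
Proof.
  intros Ha Hb Hab HU. unfold maj.
  destruct (sin_cos_sqr_bounds t) as [H1 H2]. revert H1 H2.
  generalize (sin t ^ 2 * cos t ^ 2). intros x.
  generalize (cos t ^ 2). intros y Hx Hy.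
  assert (H3 : 0 <= a + 25 / 36 * b * y <= 1) by nra.
  assert (H4 : 0 <= 3 / 14 + 7 / 6 * x <= 2 / 3) by lra.
  revert H3 H4. generalize (a + 25 / 36 * b * y) (3 / 14 + 7 / 6 * x).
  intros p q Hp Hq.
  assert (H4 : 0 <= U * q <= 1) by (split; nra).
  assert (H5 : 0 <= U * q * p <= 1) by (split; nra).
  split; nra.
Qed.

(** Only the terms linear in [t] contribute: [97/896 = 3/14 * 1/4 + 7/6 * 3/64], and 97/1792 is its
    half. *)
Lemma maj_prim_period (a b U : R) :
  maj_prim a b U (2 * PI) - maj_prim a b U 0
  = 5 / 3 * PI * (b / 4 + U * (a * (97 / 896) + 25 / 36 * b * (97 / 1792))).
Proof.
  unfold maj_prim, sc_prim22, sc_prim44, sc_prim24, sc_prim46.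
  rewrite sin_2PI, sin_0. field.
Qed.

(** The ball around [PI] slightly exceeds [[0, 2 PI]], so that both endpoints are interior and
    two-sided derivatives exist there. *)
Definition time_radius : posreal := mkposreal (PI + / 1000) ltac:(pose proof PI_RGT_0; lra).

Lemma Boule_time (t : R) :
  Boule PI time_radius t <-> - / 1000 < t < 2 * PI + / 1000.
Proof.
  unfold Boule. simpl. split; intros H.
  - apply Rabs_lt_between in H. lra.
  - apply Rabs_lt_between. lra.
Qed.

(** [maj_prim] is nondecreasing, so inside [[0, 2 PI]] the full period dominates; outside, slope 5
    over a margin of 1/1000 adds at most 5/1000. *)
Lemma maj_prim_var (a b U t : R) :
  0 <= a -> 0 <= b -> a + b = 1 -> 0 <= U <= 3 / 2 -> Boule PI time_radius t ->
  Rabs (maj_prim a b U (2 * PI) - maj_prim a b U t)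
  <= maj_prim a b U (2 * PI) - maj_prim a b U 0 + 5 / 1000.
Proof.
  intros Ha Hb Hab HU Ht. apply Boule_time in Ht.
  set (G := maj_prim a b U).
  assert (Hv : forall x y, x <= y -> 0 <= G y - G x <= 5 * (y - x)).
  { intros x y Hxy.
    destruct (MVT_gen G x y (maj a b U)) as [c [_ Hc]].
    - intros s _. apply is_derive_maj_prim.
    - intros s _. apply continuity_pt_filterlim.
      apply (ex_derive_continuous (K := R_AbsRing) G).
      eexists; apply is_derive_maj_prim.
    - rewrite Hc. destruct (maj_bounds a b U c Ha Hb Hab HU). nra. }
  pose proof PI_RGT_0.
  destruct (Hv 0 (2 * PI)) as [H0 _]; [lra |].
  apply Rabs_le.
  destruct (Rle_dec t (2 * PI)) as [H1 | H1].
  - destruct (Hv t (2 * PI) H1) as [H2 _].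
    destruct (Rle_dec 0 t) as [H3 | H3].
    + destruct (Hv 0 t H3). lra.
    + destruct (Hv t 0); lra.
  - destruct (Hv (2 * PI) t); lra.
Qed.

(** The term [a / 3] bounds the exactly integrated part. The rest is at most [21/8 X + 5/2000], and
    797/1000 leaves room for the margin; with [b = 1 - a] that estimate is a convex quadratic in
    [a], largest at an endpoint. *)
Lemma w_bound_numeric (a b t : R) :
  0 <= a -> 0 <= b -> a + b = 1 -> Boule PI time_radius t ->
  let U := 3 / 2 * a + 4 / 3 * b in
  a / 3 + Rabs (maj_prim a b U (2 * PI) - maj_prim a b U t) / 2 <= 4 / 5.
Proof.
  intros Ha Hb Hab Ht U.
  assert (HU : 0 <= U <= 3 / 2) by (unfold U; lra).
  pose proof (maj_prim_var a b U t Ha Hb Hab HU Ht) as H.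
  rewrite maj_prim_period in H.
  pose proof PI_lt_3_15 as Hpi. pose proof PI_RGT_0 as Hpi0.
  set (X := b / 4 + U * (a * (97 / 896) + 25 / 36 * b * (97 / 1792))) in H.
  assert (HX : 0 <= X).
  { unfold X. assert (0 <= U * (a * (97 / 896) + 25 / 36 * b * (97 / 1792))).
    { apply Rmult_le_pos; lra. } lra. }
  assert (H1 : 5 / 3 * PI * X <= 21 / 4 * X) by nra.
  assert (H2 : a / 3 + 21 / 8 * X <= 797 / 1000).
  { unfold X, U. replace b with (1 - a) by lra. assert (a <= 1) by lra. nra. }
  lra.
Qed.

(** The equation for [u] has contraction factor [k = a / 3 + b / 4], whence the need for
    [1 / (1 - k) <= U]. By convexity the chord between the values 3/2 at [a = 1] and 4/3 at [b = 1]
    suffices, and that chord is [U]. *)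
Lemma u_bound_numeric (a b t : R) :
  0 <= a -> 0 <= b -> a + b = 1 ->
  let U := 3 / 2 * a + 4 / 3 * b in
  let q := a * Rabs (cos t) + 5 / 6 * b * cos t ^ 2 in
  1 + Rabs (sin t * cos t) * (5 / 3 * q * U) / 2 <= U.
Proof.
  intros Ha Hb Hab U q.
  pose proof (abs_sin_cos2_le t) as H1. pose proof (abs_sin_cos3_le t) as H2.
  assert (HU : 0 <= U) by (unfold U; lra).
  assert (Hk : Rabs (sin t * cos t) * (5 / 6 * q) <= a / 3 + b / 4).
  { unfold q. rewrite Rabs_mult. rewrite <- (pow2_abs (cos t)) in H1 |- *.
    replace (Rabs (sin t) * Rabs (cos t) *
       (5 / 6 * (a * Rabs (cos t) + 5 / 6 * b * Rabs (cos t) ^ 2)))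
    with (5 / 6 * a * (Rabs (sin t) * Rabs (cos t) ^ 2)
       + 25 / 36 * b * (Rabs (sin t) * Rabs (cos t) ^ 3)) by field.
    nra. }
  apply Rle_trans with (1 + (a / 3 + b / 4) * U).
  - replace (Rabs (sin t * cos t) * (5 / 3 * q * U) / 2)
      with (Rabs (sin t * cos t) * (5 / 6 * q) * U) by field.
    nra.
  - unfold U. replace b with (1 - a) by lra. assert (a <= 1) by lra. nra.
Qed.

Lemma w_integrand_numeric (a b U t : R) :
  0 <= a -> 0 <= b -> a + b = 1 -> 0 <= U ->
  let q := a * Rabs (cos t) + 5 / 6 * b * cos t ^ 2 in
  sin t ^ 2 * (5 / 3 * (b * cos t ^ 2)
    + q * (Rabs (sin t * cos t) * (5 / 3 * q * U)))
  <= maj a b U t.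
Proof.
  intros Ha Hb Hab HU q.
  (* Convexity of the square with weights [a + b = 1]: [(a + b z)^2 <= a + b z^2] for
     [z = 5/6 |cos t|]. *)
  assert (Hq : q ^ 2 <= cos t ^ 2 * (a + 25 / 36 * b * cos t ^ 2)).
  { unfold q. rewrite <- (pow2_abs (cos t)).
    set (y := Rabs (cos t)).
    replace ((a * y + 5 / 6 * b * y ^ 2) ^ 2)
      with (y ^ 2 * (a + b * (5 / 6 * y)) ^ 2) by field.
    apply Rmult_le_compat_l; [apply pow2_ge_0 |].
    replace (25 / 36 * b * y ^ 2) with (b * (5 / 6 * y) ^ 2) by field.
    generalize (5 / 6 * y). intros z. replace b with (1 - a) by lra.
    assert (0 <= a * (1 - a) * (1 - z) ^ 2).
    { apply Rmult_le_pos; [nra | apply pow2_ge_0]. }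
    nra. }
  pose proof (abs_sin_cos_le t) as Hsc. pose proof (Rabs_pos (sin t * cos t)) as Hsc0.
  replace (sin t ^ 2 * (5 / 3 * (b * cos t ^ 2)
      + q * (Rabs (sin t * cos t) * (5 / 3 * q * U))))
    with (5 / 3 * sin t ^ 2 * (b * cos t ^ 2
      + U * (Rabs (sin t * cos t) * q ^ 2))) by field.
  apply Rle_trans with (5 / 3 * sin t ^ 2 * (b * cos t ^ 2
      + U * ((3 / 14 + 7 / 6 * (sin t ^ 2 * cos t ^ 2))
             * (cos t ^ 2 * (a + 25 / 36 * b * cos t ^ 2))))).
  - pose proof (pow2_ge_0 (sin t)). apply Rmult_le_compat_l; [lra |].
    apply Rplus_le_compat_l. apply Rmult_le_compat_l; [exact HU |].
    apply Rmult_le_compat; trivial. apply pow2_ge_0.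
  - apply Req_le. unfold maj. ring.
Qed.

(** * The system for the coefficients *)

(* [tail_ser lam c r m k] is the sum of [lam i * c ^ i * r ^ (i - k)] over
   [k <= i < k + m], in Horner form. *)
Fixpoint tail_ser (lam : nat -> R) (c : R) (r : nat -> R) (m k : nat) : nat -> R :=
  match m with
  | 0%nat => PS_const 0
  | S m' => PS_plus (PS_const (lam k * c ^ k)) (PS_mult r (tail_ser lam c r m' (S k)))
  end.

(** With [r = z h] and [m = d - 1], [Q_ser] is [p (r cos) / r], and [H_ser] is what remains of it
    after removing [lambda_1 cos] and dividing by [r]. *)
Definition H_ser (lam : nat -> R) (m : nat) (t : R) (h : nat -> R) : nat -> R :=
  tail_ser lam (cos t) (PS_incr_1 h) m 2.

Definition Q_ser (lam : nat -> R) (m : nat) (t : R) (h : nat -> R) : nat -> R :=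
  PS_plus (PS_const (lam 1%nat * cos t)) (PS_mult (PS_incr_1 h) (H_ser lam m t h)).

Definition u_ser (lam : nat -> R) (m : nat) (t : R) (h u : nat -> R) : nat -> R :=
  PS_scal (sin t * cos t) (PS_mult (PS_mult h (Q_ser lam m t h)) u).

(** Since [u = 1 + z u_ser] and [Q = lambda_1 cos + z h H], the product [Q u] equals
    [lambda_1 cos + z (h H + Q u_ser)]. This isolates the term to be integrated exactly. *)
Definition w_ser (lam : nat -> R) (m : nat) (t : R) (h u : nat -> R) : nat -> R :=
  PS_scal (sin t ^ 2)
    (PS_plus (PS_mult h (H_ser lam m t h))
             (PS_mult (Q_ser lam m t h) (u_ser lam m t h u))).

(* Encoding: [r = z h], [1 / r = 1 / z - w] and [u = 1 / (1 - sin cos p(r cos))]. *)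
Record jet := Jet { jh : R -> nat -> R; ju : R -> nat -> R; jw : R -> nat -> R }.

(** The first line is [h (1 - z w) = 1] solved for [h]. In the last, both summands vanish at
    [2 * PI], which encodes the condition [r (2 PI) = z]. *)
Definition jet_step (lam : nat -> R) (m : nat) (J : jet) : jet := {|
  jh := fun t => PS_plus (PS_const 1) (PS_incr_1 (PS_mult (jw J t) (jh J t)));
  ju := fun t => PS_plus (PS_const 1) (PS_incr_1 (u_ser lam m t (jh J t) (ju J t)));
  jw := fun t => PS_plus (PS_const (- (lam 1%nat * sin t ^ 3 / 3)))
          (PS_incr_1 (fun k =>
             RInt (fun s => w_ser lam m s (jh J s) (ju J s) k) t (2 * PI))) |}.

Fixpoint jet_iter (lam : nat -> R) (m n : nat) : jet :=
  match n with
  | 0%nat => Jet (fun _ => PS_const 1) (fun _ => PS_const 1) (fun _ => PS_const 0)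
  | S n' => jet_step lam m (jet_iter lam m n')
  end.

(** * Congruence modulo [z ^ n] and stabilisation of the Picard iterates *)

Definition agree (n : nat) (a b : nat -> R) : Prop :=
  forall k, (k < n)%nat -> a k = b k.

Lemma agree_plus (n : nat) (a a' b b' : nat -> R) :
  agree n a a' -> agree n b b' -> agree n (PS_plus a b) (PS_plus a' b').
Proof. intros Ha Hb k Hk. unfold PS_plus. now rewrite Ha, Hb. Qed.

Lemma agree_scal (n : nat) (c : R) (a a' : nat -> R) :
  agree n a a' -> agree n (PS_scal c a) (PS_scal c a').
Proof. intros Ha k Hk. unfold PS_scal. now rewrite Ha. Qed.

Lemma agree_mult (n : nat) (a a' b b' : nat -> R) :
  agree n a a' -> agree n b b' -> agree n (PS_mult a b) (PS_mult a' b').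
Proof.
  intros Ha Hb k Hk. unfold PS_mult. apply sum_eq. intros i Hi.
  rewrite Ha, Hb by lia. reflexivity.
Qed.

Lemma agree_incr (n : nat) (a a' : nat -> R) :
  agree n a a' -> agree (S n) (PS_incr_1 a) (PS_incr_1 a').
Proof. intros Ha [|k] Hk; simpl; [reflexivity | apply Ha; lia]. Qed.

Lemma agree_refl (n : nat) (a : nat -> R) : agree n a a.
Proof. intros k _. reflexivity. Qed.

Lemma agree_le (n n' : nat) (a b : nat -> R) :
  (n' <= n)%nat -> agree n a b -> agree n' a b.
Proof. intros Hn Ha k Hk. apply Ha. lia. Qed.

Lemma agree_tail (n : nat) (lam : nat -> R) (c : R) (r r' : nat -> R) (m k : nat) :
  agree n r r' -> agree n (tail_ser lam c r m k) (tail_ser lam c r' m k).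
Proof.
  intros Hr. revert k. induction m as [|m IH]; intros k; simpl.
  - apply agree_refl.
  - apply agree_plus; [apply agree_refl | apply agree_mult; auto].
Qed.

Lemma agree_H (n : nat) (lam : nat -> R) (m : nat) (t : R) (h h' : nat -> R) :
  agree n h h' -> agree n (H_ser lam m t h) (H_ser lam m t h').
Proof.
  intros Hh. apply agree_tail. apply agree_le with (S n); [lia | now apply agree_incr].
Qed.

Lemma agree_Q (n : nat) (lam : nat -> R) (m : nat) (t : R) (h h' : nat -> R) :
  agree n h h' -> agree n (Q_ser lam m t h) (Q_ser lam m t h').
Proof.
  intros Hh. apply agree_plus; [apply agree_refl |].
  apply agree_mult; [| now apply agree_H].
  apply agree_le with (S n); [lia | now apply agree_incr].
Qed.

Lemma agree_u (n : nat) (lam : nat -> R) (m : nat) (t : R) (h h' u u' : nat -> R) :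
  agree n h h' -> agree n u u' -> agree n (u_ser lam m t h u) (u_ser lam m t h' u').
Proof.
  intros Hh Hu. apply agree_scal. apply agree_mult; [| exact Hu].
  apply agree_mult; [exact Hh | now apply agree_Q].
Qed.

Lemma agree_w (n : nat) (lam : nat -> R) (m : nat) (t : R) (h h' u u' : nat -> R) :
  agree n h h' -> agree n u u' -> agree n (w_ser lam m t h u) (w_ser lam m t h' u').
Proof.
  intros Hh Hu. apply agree_scal. apply agree_plus.
  - apply agree_mult; [exact Hh | now apply agree_H].
  - apply agree_mult; [now apply agree_Q | now apply agree_u].
Qed.

Definition jet_agree (n : nat) (J J' : jet) : Prop :=
  forall t, agree n (jh J t) (jh J' t) /\ agree n (ju J t) (ju J' t)
            /\ agree n (jw J t) (jw J' t).

(** Every component is a constant series plus [z] times an expression in the old jet, so one step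
    gains one coefficient. *)
Lemma jet_step_agree (lam : nat -> R) (m n : nat) (J J' : jet) :
  jet_agree n J J' -> jet_agree (S n) (jet_step lam m J) (jet_step lam m J').
Proof.
  intros HJ t. destruct (HJ t) as [Hh [Hu Hw]]. simpl.
  repeat split; (apply agree_plus; [apply agree_refl | apply agree_incr]).
  - now apply agree_mult.
  - now apply agree_u.
  - intros k Hk. apply RInt_ext. intros s _.
    destruct (HJ s) as [Hhs [Hus _]].
    exact (agree_w n lam m s _ _ _ _ Hhs Hus k Hk).
Qed.

Lemma jet_iter_agree (lam : nat -> R) (m n n' : nat) :
  (n <= n')%nat -> jet_agree n (jet_iter lam m n) (jet_iter lam m n').
Proof.
  revert n'. induction n as [|n IH]; intros n' Hn.
  - intros t. repeat split; intros k Hk; lia.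
  - destruct n' as [|n']; [lia |]. simpl. apply jet_step_agree, IH. lia.
Qed.

(** Coefficient [k] is read off iterate [S k], from which on it no longer changes. *)
Definition jet_lim (lam : nat -> R) (m : nat) : jet := {|
  jh := fun t k => jh (jet_iter lam m (S k)) t k;
  ju := fun t k => ju (jet_iter lam m (S k)) t k;
  jw := fun t k => jw (jet_iter lam m (S k)) t k |}.

Lemma jet_lim_agree (lam : nat -> R) (m n : nat) :
  jet_agree n (jet_lim lam m) (jet_iter lam m n).
Proof.
  intros t. repeat split; intros k Hk;
    destruct (jet_iter_agree lam m (S k) n Hk t) as [Hh [Hu Hw]]; simpl;
    [apply Hh | apply Hu | apply Hw]; lia.
Qed.

Lemma jet_lim_fixed (lam : nat -> R) (m : nat) (t : R) (k : nat) :
  jh (jet_lim lam m) t k = jh (jet_step lam m (jet_lim lam m)) t k /\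
  ju (jet_lim lam m) t k = ju (jet_step lam m (jet_lim lam m)) t k /\
  jw (jet_lim lam m) t k = jw (jet_step lam m (jet_lim lam m)) t k.
Proof.
  (* The limit agrees with iterate [k] below degree [k], so its step agrees with iterate [S k] up to
     degree [k] included, exactly where the limit takes its coefficient [k]. *)
  destruct (jet_step_agree lam m k _ _ (jet_lim_agree lam m k) t) as [Hh [Hu Hw]].
  rewrite Hh, Hu, Hw by lia. repeat split; reflexivity.
Qed.

(** * Continuity of the coefficients in the angle *)

Definition coef_continuous (a : R -> nat -> R) : Prop :=
  forall k x, continuous (fun s => a s k) x.

Lemma coef_continuous_const (c : R -> R) :
  (forall x, continuous c x) -> coef_continuous (fun s => PS_const (c s)).
Proof. intros Hc [|k] x; simpl; [apply Hc | apply continuous_const]. Qed.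

Lemma coef_continuous_plus (a b : R -> nat -> R) :
  coef_continuous a -> coef_continuous b ->
  coef_continuous (fun s => PS_plus (a s) (b s)).
Proof.
  intros Ha Hb k x.
  apply (continuous_plus (fun s => a s k) (fun s => b s k)); [apply Ha | apply Hb].
Qed.

Lemma coef_continuous_scal (c : R -> R) (a : R -> nat -> R) :
  (forall x, continuous c x) -> coef_continuous a ->
  coef_continuous (fun s => PS_scal (c s) (a s)).
Proof.
  intros Hc Ha k x.
  apply (continuous_mult c (fun s => a s k)); [apply Hc | apply Ha].
Qed.

Lemma coef_continuous_incr (a : R -> nat -> R) :
  coef_continuous a -> coef_continuous (fun s => PS_incr_1 (a s)).
Proof. intros Ha [|k] x; simpl; [apply continuous_const | apply Ha]. Qed.

Lemma continuous_sum_f_R0 (f : R -> nat -> R) (n : nat) (x : R) :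
  (forall k, continuous (fun s => f s k) x) ->
  continuous (fun s => sum_f_R0 (f s) n) x.
Proof.
  intros Hf. induction n as [|n IH]; simpl.
  - apply Hf.
  - apply (continuous_plus (fun s => sum_f_R0 (f s) n)); [exact IH | apply Hf].
Qed.

Lemma coef_continuous_mult (a b : R -> nat -> R) :
  coef_continuous a -> coef_continuous b ->
  coef_continuous (fun s => PS_mult (a s) (b s)).
Proof.
  intros Ha Hb k x. unfold PS_mult.
  apply (continuous_sum_f_R0 (fun s i => a s i * b s (k - i)%nat)). intros i.
  apply (continuous_mult (fun s => a s i) (fun s => b s (k - i)%nat));
    [apply Ha | apply Hb].
Qed.

Lemma continuous_of_ex_derive (f : R -> R) (x : R) : ex_derive f x -> continuous f x.
Proof. apply (ex_derive_continuous (K := R_AbsRing) f). Qed.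

Lemma coef_continuous_tail (lam : nat -> R) (r : R -> nat -> R) (m k : nat) :
  coef_continuous r -> coef_continuous (fun s => tail_ser lam (cos s) (r s) m k).
Proof.
  intros Hr. revert k. induction m as [|m IH]; intros k; simpl.
  - apply coef_continuous_const. intros x. apply continuous_const.
  - apply (coef_continuous_plus (fun s => PS_const (lam k * cos s ^ k))).
    + apply (coef_continuous_const (fun s => lam k * cos s ^ k)). intros x.
      apply continuous_of_ex_derive. auto_derive. trivial.
    + apply coef_continuous_mult; [exact Hr | apply IH].
Qed.

Lemma coef_continuous_H (lam : nat -> R) (m : nat) (h : R -> nat -> R) :
  coef_continuous h -> coef_continuous (fun s => H_ser lam m s (h s)).
Proof.
  intros Hh. apply coef_continuous_tail, coef_continuous_incr, Hh.
Qed.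

Lemma coef_continuous_Q (lam : nat -> R) (m : nat) (h : R -> nat -> R) :
  coef_continuous h -> coef_continuous (fun s => Q_ser lam m s (h s)).
Proof.
  intros Hh. apply coef_continuous_plus.
  - apply (coef_continuous_const (fun s => lam 1%nat * cos s)). intros x.
    apply continuous_of_ex_derive. auto_derive. trivial.
  - apply coef_continuous_mult; [now apply coef_continuous_incr |].
    now apply coef_continuous_H.
Qed.

Lemma coef_continuous_u (lam : nat -> R) (m : nat) (h u : R -> nat -> R) :
  coef_continuous h -> coef_continuous u ->
  coef_continuous (fun s => u_ser lam m s (h s) (u s)).
Proof.
  intros Hh Hu. apply (coef_continuous_scal (fun s => sin s * cos s)).
  - intros x. apply continuous_of_ex_derive. auto_derive. trivial.
  - apply coef_continuous_mult; [| exact Hu].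
    apply coef_continuous_mult; [exact Hh | now apply coef_continuous_Q].
Qed.

Lemma coef_continuous_w (lam : nat -> R) (m : nat) (h u : R -> nat -> R) :
  coef_continuous h -> coef_continuous u ->
  coef_continuous (fun s => w_ser lam m s (h s) (u s)).
Proof.
  intros Hh Hu. apply (coef_continuous_scal (fun s => sin s ^ 2)).
  - intros x. apply continuous_of_ex_derive. auto_derive. trivial.
  - apply coef_continuous_plus.
    + apply coef_continuous_mult; [exact Hh | now apply coef_continuous_H].
    + apply coef_continuous_mult; [now apply coef_continuous_Q |].
      now apply coef_continuous_u.
Qed.

Lemma jet_iter_continuous (lam : nat -> R) (m n : nat) :
  coef_continuous (jh (jet_iter lam m n)) /\
  coef_continuous (ju (jet_iter lam m n)) /\
  coef_continuous (jw (jet_iter lam m n)).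
Proof.
  induction n as [|n [Hh [Hu Hw]]]; simpl.
  - repeat split; apply coef_continuous_const; intros x; apply continuous_const.
  - repeat split.
    + apply coef_continuous_plus.
      * apply coef_continuous_const. intros x. apply continuous_const.
      * apply coef_continuous_incr. now apply coef_continuous_mult.
    + apply coef_continuous_plus.
      * apply coef_continuous_const. intros x. apply continuous_const.
      * apply coef_continuous_incr. now apply coef_continuous_u.
    + apply coef_continuous_plus.
      * apply (coef_continuous_const (fun s => - (lam 1%nat * sin s ^ 3 / 3))).
        intros x. apply continuous_of_ex_derive. auto_derive. trivial.
      * apply coef_continuous_incr. intros k x. apply continuous_of_ex_derive.
        eexists. apply is_derive_RInt_left. intros y.
        now apply (coef_continuous_w lam m).
Qed.

Lemma jet_lim_continuous (lam : nat -> R) (m : nat) :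
  coef_continuous (jh (jet_lim lam m)) /\ coef_continuous (ju (jet_lim lam m)).
Proof.
  split; intros k x; destruct (jet_iter_continuous lam m (S k)) as [Hh [Hu _]];
    [exact (Hh k x) | exact (Hu k x)].
Qed.

(** * A priori bounds *)

Fixpoint abs_tail (lam : nat -> R) (m k : nat) : R :=
  match m with
  | 0%nat => 0
  | S m' => Rabs (lam k) + abs_tail lam m' (S k)
  end.

Lemma abs_tail_ge0 (lam : nat -> R) (m k : nat) : 0 <= abs_tail lam m k.
Proof.
  revert k. induction m as [|m IH]; intros k; simpl; [lra |].
  pose proof (Rabs_pos (lam k)). specialize (IH (S k)). lra.
Qed.

(** All powers [c ^ i] with [i >= 2] are at most [c ^ 2]. Keeping this factor, instead of bounding
    it by 1, is what the trigonometric estimates rely on. *)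
Lemma bounded_by_tail (lam : nat -> R) (c : R) (r : nat -> R) (m k : nat) :
  bounded_by r 1 -> Rabs c <= 1 -> (2 <= k)%nat ->
  bounded_by (tail_ser lam c r m k) (abs_tail lam m k * c ^ 2).
Proof.
  intros Hr Hc. revert k. induction m as [|m IH]; intros k Hk; simpl tail_ser; simpl abs_tail.
  - apply bounded_by_le with (1 := bounded_by_const 0). rewrite Rabs_R0. lra.
  - apply bounded_by_le with (Rabs (lam k * c ^ k) + 1 * (abs_tail lam m (S k) * c ^ 2)).
    + apply bounded_by_plus; [apply bounded_by_const |].
      apply bounded_by_mult; [exact Hr | apply IH; lia].
    + assert (H : Rabs (c ^ k) <= c ^ 2).
      { replace k with (2 + (k - 2))%nat by lia.
        rewrite pow_add, Rabs_mult, <- !RPow_abs, pow2_abs.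
        assert (0 <= Rabs c ^ (k - 2) <= 1).
        { pose proof (Rabs_pos c). split; [now apply pow_le |].
          rewrite <- (pow1 (k - 2)). apply pow_incr. lra. }
        pose proof (pow2_ge_0 c). nra. }
      rewrite Rabs_mult. pose proof (Rabs_pos (lam k)). nra.
Qed.

(** As [r = z h] and [z] has norm 1/2, the bound 5/3 on [h] is the bound 5/6 on [r]. *)
Definition jet_bounded (U : R) (J : jet) (t : R) : Prop :=
  bounded_by (jh J t) (5 / 3) /\ bounded_by (ju J t) U /\ bounded_by (jw J t) (4 / 5).

Lemma bounded_by_H (lam : nat -> R) (m : nat) (t : R) (h : nat -> R) :
  bounded_by h (5 / 3) ->
  bounded_by (H_ser lam m t h) (abs_tail lam m 2 * cos t ^ 2).
Proof.
  intros Hh. apply bounded_by_tail; [| | lia].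
  - apply bounded_by_le with (1 := bounded_by_incr _ _ Hh). lra.
  - apply Rabs_le. apply COS_bound.
Qed.

Lemma bounded_by_Q (lam : nat -> R) (m : nat) (t : R) (h : nat -> R) :
  bounded_by h (5 / 3) ->
  bounded_by (Q_ser lam m t h)
    (Rabs (lam 1%nat) * Rabs (cos t) + 5 / 6 * abs_tail lam m 2 * cos t ^ 2).
Proof.
  intros Hh. rewrite <- Rabs_mult. apply bounded_by_plus.
  - apply bounded_by_const.
  - rewrite Rmult_assoc. apply bounded_by_mult; [| now apply bounded_by_H].
    apply bounded_by_le with (1 := bounded_by_incr _ _ Hh). lra.
Qed.

Lemma bounded_by_u (lam : nat -> R) (m : nat) (t U : R) (h u : nat -> R) :
  bounded_by h (5 / 3) -> bounded_by u U ->
  bounded_by (u_ser lam m t h u)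
    (Rabs (sin t * cos t) *
      (5 / 3 * (Rabs (lam 1%nat) * Rabs (cos t) + 5 / 6 * abs_tail lam m 2 * cos t ^ 2) * U)).
Proof.
  intros Hh Hu. apply bounded_by_scal, bounded_by_mult; [| exact Hu].
  apply bounded_by_mult; [exact Hh | now apply bounded_by_Q].
Qed.

Lemma bounded_by_w (lam : nat -> R) (m : nat) (t U : R) (h u : nat -> R) :
  Rabs (lam 1%nat) + abs_tail lam m 2 = 1 -> 0 <= U ->
  bounded_by h (5 / 3) -> bounded_by u U ->
  bounded_by (w_ser lam m t h u) (maj (Rabs (lam 1%nat)) (abs_tail lam m 2) U t).
Proof.
  intros Hab HU Hh Hu.
  eapply bounded_by_le.
  - apply bounded_by_scal, bounded_by_plus; apply bounded_by_mult.
    + exact Hh.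
    + now apply bounded_by_H.
    + now apply bounded_by_Q.
    + now apply bounded_by_u.
  - rewrite (Rabs_pos_eq (sin t ^ 2)) by apply pow2_ge_0.
    apply w_integrand_numeric; trivial; [apply Rabs_pos | apply abs_tail_ge0].
Qed.

Lemma jet_iter_bounded (lam : nat -> R) (m n : nat) (t : R) :
  Rabs (lam 1%nat) + abs_tail lam m 2 = 1 -> Boule PI time_radius t ->
  jet_bounded (3 / 2 * Rabs (lam 1%nat) + 4 / 3 * abs_tail lam m 2) (jet_iter lam m n) t.
Proof.
  intros Hab. pose proof (Rabs_pos (lam 1%nat)) as Ha.
  pose proof (abs_tail_ge0 lam m 2) as Hb.
  set (a := Rabs (lam 1%nat)) in *. set (b := abs_tail lam m 2) in *.
  set (U := 3 / 2 * a + 4 / 3 * b).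
  assert (HU : 0 <= U) by (unfold U; lra).
  revert t. induction n as [|n IH]; intros t Ht.
  - repeat split; simpl.
    + apply bounded_by_le with (1 := bounded_by_const 1). rewrite Rabs_R1. lra.
    + apply bounded_by_le with (1 := bounded_by_const 1). rewrite Rabs_R1.
      unfold U; lra.
    + apply bounded_by_le with (1 := bounded_by_const 0). rewrite Rabs_R0. lra.
  - destruct (IH t Ht) as [Hh [Hu Hw]]. simpl. repeat split; simpl.
    + eapply bounded_by_le.
      * apply bounded_by_plus; [apply bounded_by_const |].
        apply bounded_by_incr, bounded_by_mult; [exact Hw | exact Hh].
      (* The bound closes with equality: [1 + (4/5 * 5/3) / 2 = 5/3]. *)
      * rewrite Rabs_R1. lra.
    + eapply bounded_by_le.
      * apply bounded_by_plus; [apply bounded_by_const |].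
        apply bounded_by_incr, bounded_by_u; [exact Hh | exact Hu].
      * rewrite Rabs_R1. apply u_bound_numeric; trivial.
    + eapply bounded_by_le.
      * apply bounded_by_plus; [apply bounded_by_const |].
        apply bounded_by_incr.
        (* The integral from [t] to [2 * PI] uses the induction hypothesis at all intermediate
           times, which lie in the same ball. *)
        apply bounded_by_RInt with (G := maj_prim a b U) (g := maj a b U).
        -- destruct (jet_iter_continuous lam m n) as [Ch [Cu _]].
           now apply coef_continuous_w.
        -- intros s Hs. split; [apply is_derive_maj_prim |].
           assert (Hs' : Boule PI time_radius s).
           { pose proof PI_RGT_0. apply Boule_time. apply Boule_time in Ht.
             revert Hs. unfold Rmin, Rmax. destruct (Rle_dec t (2 * PI)); lra. }
           destruct (IH s Hs') as [Hhs [Hus _]]. now apply bounded_by_w.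
      * apply Rle_trans with (2 := w_bound_numeric a b t Ha Hb Hab Ht).
        apply Rplus_le_compat_r.
        assert (H1 : Rabs (sin t ^ 3) <= 1).
        { rewrite <- RPow_abs, <- (pow1 3). apply pow_incr. split; [apply Rabs_pos |].
          apply Rabs_le. apply SIN_bound. }
        rewrite Rabs_Ropp, Rabs_div, Rabs_mult, (Rabs_pos_eq 3) by lra.
        apply Rmult_le_compat_r; [lra |].
        rewrite <- (Rmult_1_r a). now apply Rmult_le_compat_l.
Qed.

(** The partial sum up to [N] of the limit is that of iterate [S N], where the bound is known. *)
Lemma jet_lim_bounded (lam : nat -> R) (m : nat) (t : R) :
  Rabs (lam 1%nat) + abs_tail lam m 2 = 1 -> Boule PI time_radius t ->
  jet_bounded (3 / 2 * Rabs (lam 1%nat) + 4 / 3 * abs_tail lam m 2) (jet_lim lam m) t.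
Proof.
  intros Hab Ht.
  assert (K : forall a b M N, agree (S N) a b -> bounded_by b M ->
     sum_f_R0 (fun k => Rabs (a k) * (/ 2) ^ k) N <= M).
  { intros a b M N E Hb. apply Rle_trans with (2 := Hb N). apply Req_le, sum_eq.
    intros k Hk. rewrite E by lia. reflexivity. }
  repeat split; intros N;
    destruct (jet_lim_agree lam m (S N) t) as [Eh [Eu Ew]];
    destruct (jet_iter_bounded lam m (S N) t Hab Ht) as [Hh [Hu Hw]];
    [apply K with (1 := Eh) | apply K with (1 := Eu) | apply K with (1 := Ew)]; trivial.
Qed.

(** * Summation of the series *)

Lemma PSeries_mult_bounded (a b : nat -> R) (M M' x : R) :
  bounded_by a M -> bounded_by b M' -> Rabs x < / 2 ->
  PSeries (PS_mult a b) x = PSeries a x * PSeries b x.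
Proof.
  intros Ha Hb Hx. apply PSeries_mult.
  - exact (bounded_by_CV_radius _ _ _ Ha Hx).
  - exact (bounded_by_CV_radius _ _ _ Hb Hx).
Qed.

Lemma PSeries_plus_bounded (a b : nat -> R) (M M' x : R) :
  bounded_by a M -> bounded_by b M' -> Rabs x < / 2 ->
  PSeries (PS_plus a b) x = PSeries a x + PSeries b x.
Proof.
  intros Ha Hb Hx. apply PSeries_plus.
  - exact (bounded_by_ex_pseries _ _ _ Ha Hx).
  - exact (bounded_by_ex_pseries _ _ _ Hb Hx).
Qed.

Fixpoint tail_val (lam : nat -> R) (c r : R) (m k : nat) : R :=
  match m with
  | 0%nat => 0
  | S m' => lam k * c ^ k + r * tail_val lam c r m' (S k)
  end.

Lemma PSeries_tail (lam : nat -> R) (c : R) (r : nat -> R) (m k : nat) (x : R) :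
  bounded_by r 1 -> Rabs c <= 1 -> (2 <= k)%nat -> Rabs x < / 2 ->
  PSeries (tail_ser lam c r m k) x = tail_val lam c (PSeries r x) m k.
Proof.
  intros Hr Hc Hk Hx. revert k Hk. induction m as [|m IH]; intros k Hk; simpl.
  - now apply PSeries_PS_const.
  - pose proof (bounded_by_tail lam c r m (S k) Hr Hc ltac:(lia)) as Ht.
    rewrite (PSeries_plus_bounded _ _ _ _ _ (bounded_by_const _)
      (bounded_by_mult _ _ _ _ Hr Ht) Hx).
    rewrite (PSeries_mult_bounded _ _ _ _ _ Hr Ht Hx), PSeries_PS_const, IH by (lia || exact Hx).
    reflexivity.
Qed.

Lemma tail_val_sum (lam : nat -> R) (c r : R) (m k u : nat) :
  S u = (k + m)%nat -> (1 <= k)%nat ->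
  r ^ k * tail_val lam c r m k = sum_n_m (fun i => lam i * (r * c) ^ i) k u.
Proof.
  revert k. induction m as [|m IH]; intros k Hu Hk; simpl tail_val.
  - rewrite sum_n_m_zero by lia. apply Rmult_0_r.
  - rewrite sum_Sn_m by lia. rewrite <- IH by lia.
    change (r ^ k * (lam k * c ^ k + r * tail_val lam c r m (S k))
      = lam k * (r * c) ^ k + r ^ S k * tail_val lam c r m (S k)).
    rewrite Rpow_mult_distr. simpl. ring.
Qed.

Lemma abs_tail_sum (lam : nat -> R) (m k u : nat) :
  S u = (k + m)%nat -> (1 <= k)%nat ->
  abs_tail lam m k = sum_n_m (fun i => Rabs (lam i)) k u.
Proof.
  revert k. induction m as [|m IH]; intros k Hu Hk; simpl abs_tail.
  - rewrite sum_n_m_zero by lia. reflexivity.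
  - rewrite sum_Sn_m by lia. rewrite <- IH by lia. reflexivity.
Qed.

(** For [k >= n], [|x|^k = (2 |x|)^k / 2^k <= (2 |x|)^n / 2^k], so the tail is at most [(2 |x|)^n]
    times the norm. The estimate depends on the series only through [M], hence is uniform in the
    angle. *)
Lemma PSeries_remainder (a : nat -> R) (M x : R) (n : nat) :
  bounded_by a M -> Rabs x < / 2 ->
  Rabs (PSeries a x - sum_f_R0 (fun k => a k * x ^ k) n) <= M * (2 * Rabs x) ^ n.
Proof.
  intros Ha Hx.
  set (q := 2 * Rabs x).
  assert (Hq : 0 <= q <= 1) by (unfold q; pose proof (Rabs_pos x); lra).
  set (S := sum_f_R0 (fun k => a k * x ^ k)).
  set (T := sum_f_R0 (fun k => Rabs (a k) * (/ 2) ^ k)).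
  assert (H : forall p, Rabs (S (n + p)%nat - S n) <= q ^ n * (T (n + p)%nat - T n)).
  { induction p as [|p IH].
    - rewrite Nat.add_0_r. replace (S n - S n) with 0 by ring.
      rewrite Rabs_R0. lra.
    - rewrite Nat.add_succ_r.
      change (S (Datatypes.S (n + p)))
        with (S (n + p)%nat + a (Datatypes.S (n + p)) * x ^ Datatypes.S (n + p)).
      change (T (Datatypes.S (n + p)))
        with (T (n + p)%nat + Rabs (a (Datatypes.S (n + p))) * (/ 2) ^ Datatypes.S (n + p)).
      set (k := Datatypes.S (n + p)).
      assert (Hk : Rabs (a k * x ^ k) <= q ^ n * (Rabs (a k) * (/ 2) ^ k)).
      { rewrite Rabs_mult, <- RPow_abs.
        replace (Rabs x) with (q * / 2) by (unfold q; field).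
        rewrite Rpow_mult_distr.
        assert (q ^ k <= q ^ n).
        { unfold k. replace (Datatypes.S (n + p)) with (n + Datatypes.S p)%nat by lia.
          rewrite pow_add. rewrite <- (Rmult_1_r (q ^ n)) at 2.
          apply Rmult_le_compat_l; [apply pow_le; lra |].
          rewrite <- (pow1 (Datatypes.S p)). now apply pow_incr. }
        replace (q ^ n * (Rabs (a k) * (/ 2) ^ k))
          with (Rabs (a k) * (q ^ n * (/ 2) ^ k)) by ring.
        apply Rmult_le_compat_l; [apply Rabs_pos |].
        apply Rmult_le_compat_r; [apply Rlt_le, half_pow_pos | assumption]. }
      replace (S (n + p)%nat + a k * x ^ k - S n)
        with ((S (n + p)%nat - S n) + a k * x ^ k) by ring.
      eapply Rle_trans; [apply Rabs_triang |]. lra. }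
  assert (HT : forall p, q ^ n * (T (n + p)%nat - T n) <= M * q ^ n).
  { intros p. rewrite Rmult_comm. apply Rmult_le_compat_r; [apply pow_le; lra |].
    assert (0 <= T n).
    { apply cond_pos_sum. intros k.
      apply Rmult_le_pos; [apply Rabs_pos | apply Rlt_le, half_pow_pos]. }
    specialize (Ha (n + p)%nat). unfold T at 1. lra. }
  assert (Hlim : is_lim_seq (fun p => Rabs (S (n + p)%nat - S n))
                   (Rabs (PSeries a x - S n))).
  { apply (is_lim_seq_abs _ (Finite _)).
    apply is_lim_seq_minus'; [| apply is_lim_seq_const].
    apply (is_lim_seq_ext (fun p => S (p + n)%nat)).
    { intros p. now rewrite Nat.add_comm. }
    apply (is_lim_seq_incr_n S n).
    pose proof (PSeries_correct a x (bounded_by_ex_pseries _ _ _ Ha Hx)) as Hs.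
    apply is_pseries_R in Hs.
    apply (is_lim_seq_ext (sum_n (fun k => a k * x ^ k))).
    { intros p. apply sum_n_Reals. }
    exact Hs. }
  apply (is_lim_seq_le (fun p => Rabs (S (n + p)%nat - S n)) (fun _ => M * q ^ n)
    (Finite _) (Finite _)).
  - intros p. eapply Rle_trans; [apply H | apply HT].
  - exact Hlim.
  - apply is_lim_seq_const.
Qed.

(** Norm bounds uniform on the ball make the differentiated partial sums converge uniformly there,
    which permits differentiation of the limit. *)
Lemma PSeries_termwise_derive (a da : R -> nat -> R) (M M' x c t : R) (r : posreal) :
  Rabs x < / 2 -> Boule c r t ->
  (forall s, Boule c r s -> bounded_by (a s) M /\ bounded_by (da s) M') ->
  (forall s k, Boule c r s -> is_derive (fun y => a y k) s (da s k)) ->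
  is_derive (fun s => PSeries (a s) x) t (PSeries (da t) x).
Proof.
  intros Hx Ht Hb Hd.
  assert (Hq : Rabs (2 * Rabs x) < 1).
  { rewrite Rabs_pos_eq; pose proof (Rabs_pos x); lra. }
  assert (Hpow : forall K e, 0 <= K -> 0 < e ->
    exists N, forall n, (N <= n)%nat -> K * (2 * Rabs x) ^ n < e).
  { intros K e HK He.
    destruct (pow_lt_1_zero _ Hq (e / (K + 1)) ltac:(apply Rdiv_lt_0_compat; lra))
      as [N HN].
    exists N. intros n Hn. specialize (HN n Hn).
    rewrite Rabs_pos_eq in HN by (apply pow_le; pose proof (Rabs_pos x); lra).
    apply Rle_lt_trans with (K * (e / (K + 1))).
    - apply Rmult_le_compat_l; lra.
    - apply Rmult_lt_reg_r with (K + 1); [lra |].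
      replace (K * (e / (K + 1)) * (K + 1)) with (K * e) by (field; lra). nra. }
  apply is_derive_Reals.
  apply (CVU_derivable
    (fun n s => sum_f_R0 (fun k => a s k * x ^ k) n)
    (fun n s => sum_f_R0 (fun k => da s k * x ^ k) n)
    (fun s => PSeries (a s) x) (fun s => PSeries (da s) x) c r); [| | | exact Ht].
  - intros e He.
    destruct (Hpow M' e) as [N HN]; trivial.
    { destruct (Hb t Ht) as [_ H]. exact (bounded_by_ge0 _ _ H). }
    exists N. intros n s Hn Hs. destruct (Hb s Hs) as [_ H].
    eapply Rle_lt_trans; [exact (PSeries_remainder _ _ _ n H Hx) | now apply HN].
  - intros s Hs e He. destruct (Hb s Hs) as [H _].
    destruct (Hpow M e (bounded_by_ge0 _ _ H) He) as [N HN].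
    exists N. intros n Hn. unfold Rdist. rewrite Rabs_minus_sym.
    eapply Rle_lt_trans; [exact (PSeries_remainder _ _ _ n H Hx) | now apply HN].
  - intros n s Hs. apply is_derive_Reals.
    rewrite <- (sum_n_Reals (fun k => da s k * x ^ k)).
    apply (is_derive_ext (fun s => sum_n (fun k => a s k * x ^ k) n)).
    { intros y. apply sum_n_Reals. }
    apply (is_derive_sum_n (K := R_AbsRing) (V := R_NormedModule)
      (fun k y => a y k * x ^ k) n s (fun k => da s k * x ^ k)).
    intros k _. apply (is_derive_scal_l (V := R_NormedModule)). now apply Hd.
Qed.

(** * The summed series solves the polar equation *)

(** This is [- sin^2 Q u], with [Q u] in the split form used for [w_ser]. *)
Definition jet_dw (lam : nat -> R) (m : nat) (t : R) : nat -> R :=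
  PS_plus (PS_const (- (lam 1%nat * cos t * sin t ^ 2)))
    (PS_incr_1 (PS_scal (-1) (w_ser lam m t (jh (jet_lim lam m) t) (ju (jet_lim lam m) t)))).

Lemma is_derive_jw (lam : nat -> R) (m : nat) (t : R) (k : nat) :
  is_derive (fun s => jw (jet_lim lam m) s k) t (jet_dw lam m t k).
Proof.
  apply (is_derive_ext (fun s => jw (jet_step lam m (jet_lim lam m)) s k)).
  { intros s. symmetry. apply jet_lim_fixed. }
  destruct (jet_lim_continuous lam m) as [Ch Cu].
  destruct k as [|k].
  - apply (is_derive_ext (fun s => - (lam 1%nat * sin s ^ 3 / 3))).
    { intros s. transitivity (- (lam 1%nat * sin s ^ 3 / 3) + 0);
        [symmetry; apply Rplus_0_r | reflexivity]. }
    replace (jet_dw lam m t 0) with (- (lam 1%nat * cos t * sin t ^ 2)).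
    2: { transitivity (- (lam 1%nat * cos t * sin t ^ 2) + 0); [ring | reflexivity]. }
    auto_derive; [trivial | field].
  - set (F := fun s => w_ser lam m s (jh (jet_lim lam m) s) (ju (jet_lim lam m) s) k).
    apply (is_derive_ext (fun s => RInt F s (2 * PI))).
    { intros s. transitivity (0 + RInt F s (2 * PI));
        [symmetry; apply Rplus_0_l | reflexivity]. }
    replace (jet_dw lam m t (S k)) with (- F t).
    2: { transitivity (0 + -1 * F t); [ring | reflexivity]. }
    apply is_derive_RInt_left. intros y.
    apply (coef_continuous_w lam m _ _ Ch Cu k).
Qed.

Definition flow (lam : nat -> R) (m : nat) (t x : R) : R :=
  x * PSeries (jh (jet_lim lam m) t) x.

(** At [2 * PI] all coefficients of [w] vanish, so [h = 1 + z w h] reduces to [h = 1]. *)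
Lemma flow_2PI (lam : nat -> R) (m : nat) (x : R) :
  Rabs (lam 1%nat) + abs_tail lam m 2 = 1 -> Rabs x < / 2 ->
  flow lam m (2 * PI) x = x.
Proof.
  intros Hab Hx.
  assert (Hw : forall k, jw (jet_lim lam m) (2 * PI) k = 0).
  { intros k. destruct (jet_lim_fixed lam m (2 * PI) k) as [_ [_ E]]. rewrite E.
    destruct k as [|k].
    - transitivity (- (lam 1%nat * sin (2 * PI) ^ 3 / 3) + 0); [reflexivity |].
      rewrite sin_2PI. field.
    - transitivity (0 + RInt (fun s => w_ser lam m s (jh (jet_lim lam m) s)
        (ju (jet_lim lam m) s) k) (2 * PI) (2 * PI)); [reflexivity |].
      rewrite RInt_point. apply Rplus_0_l. }
  unfold flow.
  rewrite (PSeries_ext _ (PS_const 1)).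
  { rewrite PSeries_PS_const by exact Hx. ring. }
  intros k. destruct (jet_lim_fixed lam m (2 * PI) k) as [E _]. rewrite E.
  destruct k as [|k].
  - transitivity (1 + 0); [reflexivity | simpl; ring].
  - transitivity (0 + PS_mult (jw (jet_lim lam m) (2 * PI)) (jh (jet_lim lam m) (2 * PI)) k);
      [reflexivity |].
    unfold PS_mult. rewrite sum_eq_R0; [simpl; ring |].
    intros i _. rewrite Hw. ring.
Qed.

Lemma is_derive_inv_affine (w : R -> R) (x t dw : R) :
  1 - x * w t <> 0 -> is_derive w t dw ->
  is_derive (fun s => x / (1 - x * w s)) t (x * (x * dw) / (1 - x * w t) ^ 2).
Proof.
  intros Hw Dw. auto_derive.
  - repeat split; trivial. now exists dw.
  - replace (Derive (fun s => w s) t) with dw by (symmetry; exact (is_derive_unique _ _ _ Dw)).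
    field. exact Hw.
Qed.

Lemma flow_solution (lam : nat -> R) (m : nat) (t x : R) :
  Rabs (lam 1%nat) + abs_tail lam m 2 = 1 -> Rabs x < / 2 ->
  Boule PI time_radius t ->
  polar_den (S m) lam t (flow lam m t x) <> 0 /\
  is_derive (fun s => flow lam m s x) t (polar_rhs (S m) lam t (flow lam m t x)).
Proof.
  intros Hab Hx Ht.
  set (L := jet_lim lam m). set (a := Rabs (lam 1%nat)) in *.
  set (b := abs_tail lam m 2) in *.
  set (U := 3 / 2 * a + 4 / 3 * b).
  assert (Ha : 0 <= a) by apply Rabs_pos.
  assert (Hb : 0 <= b) by apply abs_tail_ge0.
  assert (HU : 0 <= U <= 3 / 2) by (unfold U; lra).
  assert (HB : forall s, Boule PI time_radius s -> jet_bounded U L s).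
  { intros s Hs. now apply jet_lim_bounded. }
  set (hv := fun s => PSeries (jh L s) x).
  set (wv := fun s => PSeries (jw L s) x).
  assert (Eh : forall s, Boule PI time_radius s -> hv s = 1 + x * (wv s * hv s)).
  { intros s Hs. destruct (HB s Hs) as [Bh [_ Bw]].
    transitivity (PSeries (jh (jet_step lam m L) s) x).
    { apply PSeries_ext. intros k. apply jet_lim_fixed. }
    change (jh (jet_step lam m L) s)
      with (PS_plus (PS_const 1) (PS_incr_1 (PS_mult (jw L s) (jh L s)))).
    rewrite (PSeries_plus_bounded _ _ _ _ _ (bounded_by_const _)
      (bounded_by_incr _ _ (bounded_by_mult _ _ _ _ Bw Bh)) Hx).
    rewrite PSeries_PS_const, PSeries_incr_1, (PSeries_mult_bounded _ _ _ _ _ Bw Bh Hx)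
      by exact Hx.
    reflexivity. }
  destruct (HB t Ht) as [Bh [Bu _]].
  pose proof (bounded_by_H lam m t _ Bh) as BH.
  pose proof (bounded_by_Q lam m t _ Bh) as BQ.
  pose proof (bounded_by_u lam m t _ _ _ Bh Bu) as Bus.
  set (r := x * hv t).
  set (Hv := tail_val lam (cos t) r m 2).
  set (Qv := lam 1%nat * cos t + r * Hv).
  set (uv := PSeries (ju L t) x).
  assert (EH : PSeries (H_ser lam m t (jh L t)) x = Hv).
  { unfold H_ser. rewrite PSeries_tail; trivial; try lia.
    - rewrite PSeries_incr_1. reflexivity.
    - apply bounded_by_le with (1 := bounded_by_incr _ _ Bh). lra.
    - apply Rabs_le, COS_bound. }
  assert (EQ : PSeries (Q_ser lam m t (jh L t)) x = Qv).
  { unfold Q_ser.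
    rewrite (PSeries_plus_bounded _ _ _ _ _ (bounded_by_const _)
      (bounded_by_mult _ _ _ _ (bounded_by_incr _ _ Bh) BH) Hx).
    rewrite PSeries_PS_const,
      (PSeries_mult_bounded _ _ _ _ _ (bounded_by_incr _ _ Bh) BH Hx), EH,
      PSeries_incr_1 by exact Hx.
    reflexivity. }
  assert (Eus : PSeries (u_ser lam m t (jh L t) (ju L t)) x
    = sin t * cos t * (hv t * Qv * uv)).
  { unfold u_ser. rewrite PSeries_scal.
    rewrite (PSeries_mult_bounded _ _ _ _ _ (bounded_by_mult _ _ _ _ Bh BQ) Bu Hx),
      (PSeries_mult_bounded _ _ _ _ _ Bh BQ Hx), EQ.
    reflexivity. }
  assert (Eu : uv = 1 + x * (sin t * cos t * (hv t * Qv * uv))).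
  { rewrite <- Eus.
    transitivity (PSeries (ju (jet_step lam m L) t) x).
    { apply PSeries_ext. intros k. apply jet_lim_fixed. }
    change (ju (jet_step lam m L) t)
      with (PS_plus (PS_const 1) (PS_incr_1 (u_ser lam m t (jh L t) (ju L t)))).
    rewrite (PSeries_plus_bounded _ _ _ _ _ (bounded_by_const _)
      (bounded_by_incr _ _ Bus) Hx).
    rewrite PSeries_PS_const, PSeries_incr_1 by exact Hx. reflexivity. }
  assert (Ep : lpoly (S m) lam (r * cos t) = r * Qv).
  { unfold lpoly. rewrite <- (tail_val_sum lam (cos t) r (S m) 1 (S m)) by lia.
    unfold Qv, Hv. simpl. ring. }
  (* The summed equation for [u] says that it is minus the inverse of the denominator, which
     therefore cannot vanish. *)
  assert (Eden : uv * polar_den (S m) lam t r = -1).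
  { unfold polar_den. rewrite Ep. unfold r. lra. }
  assert (Hden : polar_den (S m) lam t r <> 0).
  { intros E. rewrite E in Eden. lra. }
  split; [exact Hden |].
  assert (Dw : is_derive wv t (- (sin t ^ 2 * Qv * uv))).
  { replace (- (sin t ^ 2 * Qv * uv)) with (PSeries (jet_dw lam m t) x).
    (* The derivative of [w] has norm at most [1 + 5/2], from the exact term and half of the bound
       on [maj]; 5 is ample. *)
    - apply (PSeries_termwise_derive _ _ (4 / 5) 5 x PI t time_radius Hx Ht).
      + intros s Hs. destruct (HB s Hs) as [Bhs [Bus' Bws]]. split; [exact Bws |].
        eapply bounded_by_le.
        * apply bounded_by_plus; [apply bounded_by_const |].
          apply bounded_by_incr, bounded_by_scal.
          apply (bounded_by_w lam m s U); trivial. apply HU.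
        * fold a b. destruct (maj_bounds a b U s Ha Hb Hab HU) as [_ H].
          rewrite Rabs_Ropp, Rabs_mult, Rabs_mult.
          rewrite (Rabs_pos_eq (sin s ^ 2)) by apply pow2_ge_0.
          rewrite (Rabs_left (-1)) by lra. fold a.
          assert (0 <= a * Rabs (cos s) <= 1).
          { pose proof (Rabs_pos (cos s)).
            assert (Rabs (cos s) <= 1) by apply Rabs_le, COS_bound. nra. }
          assert (0 <= sin s ^ 2 <= 1).
          { pose proof (cos_sqr s). pose proof (pow2_ge_0 (cos s)).
            pose proof (pow2_ge_0 (sin s)). lra. }
          nra.
      + intros s k _. apply is_derive_jw.
    - unfold jet_dw. fold L.
      rewrite (PSeries_plus_bounded _ _ _ _ _ (bounded_by_const _)
        (bounded_by_incr _ _ (bounded_by_scal (-1) _ _ (bounded_by_w lam m t U _ _ Hab (proj1 HU) Bh Bu))) Hx).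
      rewrite PSeries_PS_const, PSeries_incr_1, PSeries_scal by exact Hx.
      unfold w_ser. rewrite PSeries_scal.
      rewrite (PSeries_plus_bounded _ _ _ _ _ (bounded_by_mult _ _ _ _ Bh BH)
        (bounded_by_mult _ _ _ _ BQ Bus) Hx).
      rewrite (PSeries_mult_bounded _ _ _ _ _ Bh BH Hx),
        (PSeries_mult_bounded _ _ _ _ _ BQ Bus Hx), EH, EQ, Eus.
      change (PSeries (jh L t) x) with (hv t).
      (* One factor [u] is unfolded to [1 + z u_ser], which recombines the split terms into
         [Q u]. *)
      transitivity (- (sin t ^ 2 * Qv * (1 + x * (sin t * cos t * (hv t * Qv * uv))))).
      + replace (lam 1%nat * cos t) with (Qv - r * Hv) by (unfold Qv; ring).
        unfold r. ring.
      + rewrite <- Eu. reflexivity. }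
  assert (Hxw : forall s, Boule PI time_radius s -> 1 - x * wv s <> 0).
  { intros s Hs E. specialize (Eh s Hs).
    assert (hv s * (1 - x * wv s) = 1) by lra. rewrite E in H. lra. }
  assert (Eh' : forall s, Boule PI time_radius s -> flow lam m s x = x / (1 - x * wv s)).
  { intros s Hs. unfold flow. fold L. change (PSeries (jh L s) x) with (hv s).
    specialize (Eh s Hs). specialize (Hxw s Hs).
    apply Rmult_eq_reg_r with (1 - x * wv s); [| exact Hxw].
    replace (x / (1 - x * wv s) * (1 - x * wv s)) with x by (field; exact Hxw).
    replace (x * hv s * (1 - x * wv s)) with (x * (hv s - x * (wv s * hv s))) by ring.
    replace (hv s - x * (wv s * hv s)) with 1 by lra. ring. }
  (* The closed form [x / (1 - x w)] is known only inside the ball, so the two functions are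
     compared near [t] only. *)
  apply (is_derive_ext_loc (fun s => x / (1 - x * wv s))).
  { assert (Hpos : 0 < time_radius - Rabs (t - PI)).
    { unfold Boule in Ht. lra. }
    exists (mkposreal _ Hpos). intros s Hs. symmetry. apply Eh'.
    change (Rabs (s - t) < time_radius - Rabs (t - PI)) in Hs.
    unfold Boule. replace (s - PI) with ((s - t) + (t - PI)) by ring.
    eapply Rle_lt_trans; [apply Rabs_triang |]. lra. }
  replace (polar_rhs (S m) lam t (flow lam m t x))
    with (x * (x * - (sin t ^ 2 * Qv * uv)) / (1 - x * wv t) ^ 2).
  - apply is_derive_inv_affine; [now apply Hxw | exact Dw].
  - change (flow lam m t x) with r. unfold polar_rhs. rewrite Ep.
    assert (E1 : r = x / (1 - x * wv t)) by (unfold r; apply (Eh' t Ht)).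
    assert (E2 : uv = - / polar_den (S m) lam t r).
    { apply Rmult_eq_reg_r with (polar_den (S m) lam t r); [| exact Hden].
      rewrite Eden. field. exact Hden. }
    rewrite E2.
    (* From [1 / r = 1 / x - w] one gets [r' = r^2 w']; substituting [u = - 1 / polar_den] gives the
       polar right-hand side. *)
    transitivity (- ((x / (1 - x * wv t)) ^ 2 * sin t ^ 2 * Qv * (- / polar_den (S m) lam t r))).
    + field. split; [exact Hden | now apply Hxw].
    + rewrite <- E1. field. exact Hden.
Qed.

(** * Uniqueness for the polar equation *)

(** Joint continuity is tested along pairs of continuous functions only, the form in which it is
    applied to two solutions. *)
Definition continuous2 (E : R -> R -> R) : Prop :=
  forall (f g : R -> R) (t : R), continuous f t -> continuous g t ->
    continuous (fun s => E (f s) (g s)) t.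

(** A continuous divided difference takes the place of a Lipschitz estimate: it turns the difference
    of two solutions into a solution of a linear equation. *)
Lemma pow_divided_diff (i : nat) :
  exists E : R -> R -> R,
    (forall x y, x ^ i - y ^ i = (x - y) * E x y) /\ continuous2 E.
Proof.
  induction i as [|i [E [HE CE]]].
  - exists (fun _ _ => 0). split; [intros; simpl; ring |].
    intros f g t _ _. apply continuous_const.
  - exists (fun x y => x * E x y + y ^ i). split.
    + intros x y. simpl.
      replace (x * x ^ i - y * y ^ i) with (x * (x ^ i - y ^ i) + (x - y) * y ^ i) by ring.
      rewrite HE. ring.
    + intros f g t Hf Hg.
      apply (continuous_plus (fun s => f s * E (f s) (g s)) (fun s => g s ^ i)).
      * apply (continuous_mult f (fun s => E (f s) (g s))); [exact Hf | now apply CE].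
      * apply (continuous_comp g (fun y => y ^ i)); [exact Hg |].
        apply continuous_of_ex_derive. auto_derive. trivial.
Qed.

Lemma lpoly_divided_diff (d : nat) (lam : nat -> R) :
  exists E : R -> R -> R,
    (forall x y, lpoly d lam x - lpoly d lam y = (x - y) * E x y) /\ continuous2 E.
Proof.
  unfold lpoly. induction d as [|d [E [HE CE]]].
  - exists (fun _ _ => 0). split.
    + intros x y. rewrite !sum_n_m_zero by lia. change (0 - 0 = (x - y) * 0). ring.
    + intros f g t _ _. apply continuous_const.
  - destruct (pow_divided_diff (S d)) as [P [HP CP]].
    exists (fun x y => E x y + lam (S d) * P x y). split.
    + intros x y. rewrite !sum_n_Sm by lia.
      specialize (HE x y). specialize (HP x y).
      set (X := sum_n_m (fun i => lam i * x ^ i) 1 d) in *.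
      set (Y := sum_n_m (fun i => lam i * y ^ i) 1 d) in *.
      change (X + lam (S d) * x ^ S d - (Y + lam (S d) * y ^ S d)
        = (x - y) * (E x y + lam (S d) * P x y)).
      replace (X + lam (S d) * x ^ S d - (Y + lam (S d) * y ^ S d))
        with ((X - Y) + lam (S d) * (x ^ S d - y ^ S d)) by ring.
      rewrite HE, HP. ring.
    + intros f g t Hf Hg.
      apply (continuous_plus (fun s => E (f s) (g s)) (fun s => lam (S d) * P (f s) (g s))).
      * now apply CE.
      * apply (continuous_mult (fun _ => lam (S d)) (fun s => P (f s) (g s)));
          [apply continuous_const | now apply CP].
Qed.

(** With [l] the maximum of [|K|], the function [D^2 exp (2 l t)] is nondecreasing. It is
    nonnegative and vanishes at [b], hence also at [a]. *)
Lemma linear_ode_zero (D K : R -> R) (a b : R) :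
  a <= b ->
  (forall t, a <= t <= b -> is_derive D t (K t * D t) /\ continuity_pt K t) ->
  D b = 0 -> D a = 0.
Proof.
  intros Hab H Hb.
  destruct (continuity_ab_maj (fun t => Rabs (K t)) a b Hab) as [M [HM _]].
  { intros t Ht. apply (continuity_pt_comp K Rabs); [now apply H | apply Rcontinuity_abs]. }
  set (l := Rabs (K M)) in *.
  destruct (MVT_gen (fun t => D t ^ 2 * exp (2 * l * t)) a b
    (fun t => 2 * (K t + l) * D t ^ 2 * exp (2 * l * t))) as [c [Hc Heq]].
  - rewrite Rmin_left, Rmax_right by exact Hab. intros t Ht.
    destruct (H t) as [HD _]; [lra |].
    auto_derive.
    + now exists (K t * D t).
    + replace (Derive (fun s => D s) t) with (K t * D t)
        by (symmetry; exact (is_derive_unique _ _ _ HD)).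
      ring.
  - rewrite Rmin_left, Rmax_right by exact Hab. intros t Ht.
    destruct (H t Ht) as [HD _].
    apply continuity_pt_filterlim. apply (continuous_of_ex_derive (fun t => D t ^ 2 * exp (2 * l * t))).
    auto_derive. now exists (K t * D t).
  - rewrite Rmin_left, Rmax_right in Hc by exact Hab.
    specialize (HM c Hc). apply Rabs_le_between in HM.
    assert (H1 : 0 <= 2 * (K c + l) * D c ^ 2 * exp (2 * l * c) * (b - a)).
    { pose proof (exp_pos (2 * l * c)). pose proof (pow2_ge_0 (D c)).
      apply Rmult_le_pos; [| lra]. apply Rmult_le_pos; [| lra].
      apply Rmult_le_pos; lra. }
    rewrite <- Heq, Hb in H1.
    pose proof (exp_pos (2 * l * a)). pose proof (pow2_ge_0 (D a)).
    assert (D a ^ 2 = 0) by nra.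
    apply Rsqr_0_uniq. unfold Rsqr. lra.
Qed.

Lemma polar_unique (d : nat) (lam : nat -> R) (y1 y2 : R -> R) (a b : R) :
  a <= b ->
  (forall t, a <= t <= b ->
     (polar_den d lam t (y1 t) <> 0 /\ is_derive y1 t (polar_rhs d lam t (y1 t))) /\
     (polar_den d lam t (y2 t) <> 0 /\ is_derive y2 t (polar_rhs d lam t (y2 t)))) ->
  y1 b = y2 b -> y1 a = y2 a.
Proof.
  intros Hab H Hb.
  destruct (lpoly_divided_diff d lam) as [E [HE CE]].
  set (p1 := fun t => lpoly d lam (y1 t * cos t)).
  set (p2 := fun t => lpoly d lam (y2 t * cos t)).
  (* [K] is the quotient of the difference of the right-hand sides by [y1 - y2], from [y1 p1 - y2 p2
     = p1 (y1 - y2) + y2 (p1 - p2)]. *)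
  set (K := fun t => sin t ^ 2 *
    (sin t * cos t * (p1 t * p2 t) - p1 t - y2 t * cos t * E (y1 t * cos t) (y2 t * cos t))
    * / (polar_den d lam t (y1 t) * polar_den d lam t (y2 t))).
  apply Rminus_diag_uniq.
  apply (linear_ode_zero (fun t => y1 t - y2 t) K a b Hab); [| lra].
  intros t Ht. destruct (H t Ht) as [[N1 D1] [N2 D2]]. split.
  - replace (K t * (y1 t - y2 t))
      with (polar_rhs d lam t (y1 t) - polar_rhs d lam t (y2 t)).
    + apply (is_derive_minus (V := R_NormedModule)); assumption.
    + assert (Hp : p1 t - p2 t = (y1 t - y2 t) * cos t * E (y1 t * cos t) (y2 t * cos t)).
      { unfold p1, p2. rewrite HE. ring. }
      unfold polar_rhs, K. fold (p1 t) (p2 t).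
      apply Rmult_eq_reg_r with (polar_den d lam t (y1 t) * polar_den d lam t (y2 t)).
      2: now apply Rmult_integral_contrapositive.
      transitivity (y1 t * p1 t * sin t ^ 2 * polar_den d lam t (y2 t)
        - y2 t * p2 t * sin t ^ 2 * polar_den d lam t (y1 t)); [field; auto |].
      transitivity (sin t ^ 2 *
        (sin t * cos t * (p1 t * p2 t) - p1 t
         - y2 t * cos t * E (y1 t * cos t) (y2 t * cos t)) * (y1 t - y2 t)).
      2: { field. auto. }
      unfold polar_den. fold (p1 t) (p2 t).
      transitivity (sin t ^ 2 * ((sin t * cos t * (p1 t * p2 t) - p1 t) * (y1 t - y2 t)
        - y2 t * (p1 t - p2 t))); [ring |].
      rewrite Hp. ring.
  - assert (C1 : continuous y1 t) by (apply continuous_of_ex_derive; eexists; exact D1).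
    assert (C2 : continuous y2 t) by (apply continuous_of_ex_derive; eexists; exact D2).
    assert (Cs : continuous sin t) by (apply continuous_of_ex_derive; auto_derive; trivial).
    assert (Cc : continuous cos t) by (apply continuous_of_ex_derive; auto_derive; trivial).
    assert (Cp : forall y, continuous y t -> continuous (fun s => lpoly d lam (y s * cos s)) t).
    { intros y Cy.
      (* The divided difference against 0 also yields the continuity of the polynomial itself. *)
      apply (continuous_ext (fun s => lpoly d lam 0 + y s * cos s * E (y s * cos s) 0)).
      { intros s. specialize (HE (y s * cos s) 0). lra. }
      apply (continuous_plus (fun _ => lpoly d lam 0)); [apply continuous_const |].
      assert (Cyc : continuous (fun s => y s * cos s) t) by now apply (continuous_mult y cos).
      apply (continuous_mult (fun s => y s * cos s) (fun s => E (y s * cos s) 0)); trivial.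
      apply (CE (fun s => y s * cos s) (fun _ => 0)); [exact Cyc | apply continuous_const]. }
    assert (Cd : forall y, continuous y t -> continuous (fun s => polar_den d lam s (y s)) t).
    { intros y Cy. unfold polar_den.
      apply (continuous_plus (fun _ => -1)); [apply continuous_const |].
      apply (continuous_mult (fun s => sin s * cos s)); [| now apply Cp].
      now apply (continuous_mult sin cos). }
    pose proof (Cp y1 C1) as Cp1. pose proof (Cp y2 C2) as Cp2.
    assert (C1c : continuous (fun s => y1 s * cos s) t) by now apply (continuous_mult y1 cos).
    assert (C2c : continuous (fun s => y2 s * cos s) t) by now apply (continuous_mult y2 cos).
    assert (Csc : continuous (fun s => sin s * cos s) t) by now apply (continuous_mult sin cos).
    assert (Cpp : continuous (fun s => p1 s * p2 s) t) by now apply (continuous_mult p1 p2).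
    assert (Cs2 : continuous (fun s => sin s ^ 2) t)
      by (apply continuous_of_ex_derive; auto_derive; trivial).
    pose proof (CE _ _ t C1c C2c) as CEt.
    pose proof (continuous_mult _ _ t Csc Cpp) as T1.
    pose proof (continuous_minus (V := R_NormedModule) _ _ t T1 Cp1) as T2.
    pose proof (continuous_mult _ _ t C2c CEt) as T3.
    pose proof (continuous_minus (V := R_NormedModule) _ _ t T2 T3) as T4.
    pose proof (continuous_mult _ _ t Cs2 T4) as T5.
    pose proof (continuous_mult _ _ t (Cd y1 C1) (Cd y2 C2)) as T6.
    apply continuity_pt_mult; [| apply continuity_pt_inv].
    + apply continuity_pt_filterlim. exact T5.
    + apply continuity_pt_filterlim. exact T6.
    + now apply Rmult_integral_contrapositive.
Qed.

(** * Rescaling and identification with the inverse return map *)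

Lemma lpoly_rescale (d : nat) (lam : nat -> R) (rho x : R) :
  lpoly d (fun i => lam i * rho ^ i) x = lpoly d lam (rho * x).
Proof.
  apply sum_n_m_ext. intros i. rewrite Rpow_mult_distr. apply Rmult_assoc.
Qed.

Lemma is_derive_rescale (d : nat) (lam : nat -> R) (rho : R) (y : R -> R) (t : R) :
  polar_den d (fun i => lam i * rho ^ i) t (y t) <> 0 /\
  is_derive y t (polar_rhs d (fun i => lam i * rho ^ i) t (y t)) ->
  polar_den d lam t (rho * y t) <> 0 /\
  is_derive (fun s => rho * y s) t (polar_rhs d lam t (rho * y t)).
Proof.
  unfold polar_rhs, polar_den. rewrite lpoly_rescale.
  rewrite <- Rmult_assoc. intros [H D]. split; [exact H |].
  evar_last; [apply is_derive_scal; exact D |].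
  simpl. field. exact H.
Qed.

Theorem mainTheorem7
  (d : nat) (lam : nat -> R) (rho : R)
  (sol : R -> R -> R) (delta : R) (inv : R -> R) (eps : R) :
  (1 <= d)%nat ->
  (exists i, (1 <= i <= d)%nat /\ lam i <> 0) ->
  0 < rho -> rho_sum d lam rho = 1 ->
  (* sol t r0 = r(t; r0): the solution of the polar equation with r(0; r0) = r0,
     for small initial values r0, on an open interval containing [0, 2 pi] *)
  0 < delta ->
  (forall r0, Rabs r0 < delta ->
     sol 0 r0 = r0 /\
     forall t, -1 < t < 2 * PI + 1 ->
       polar_den d lam t (sol t r0) <> 0 /\
       is_derive (fun s => sol s r0) t (polar_rhs d lam t (sol t r0))) ->
  (* inv is the local inverse near 0 of the first return map r0 |-> r(2 pi; r0) *)
  0 < eps ->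
  (forall r, Rabs r < eps -> Rabs (inv r) < delta /\ sol (2 * PI) (inv r) = r) ->
  (* its Taylor series F_lambda(z) = sum_k v_k(2 pi) z^k converges on D(0, rho/2) *)
  forall z : C, Cmod z < rho / 2 ->
    ex_series (fun k : nat => Cmult (RtoC (taylor_coef inv k)) (pow_n z k)).
Proof.
  intros Hd _ Hrho Hsum Hdelta Hsol Heps Hinv z Hz.
  destruct d as [|m]; [lia |].
  (* The rescaled parameters have absolute sum 1, the normalisation under which the bounds were
     proved. *)
  set (mu := fun i => lam i * rho ^ i).
  assert (Hab : Rabs (mu 1%nat) + abs_tail mu m 2 = 1).
  { transitivity (abs_tail mu (S m) 1); [reflexivity |].
    rewrite (abs_tail_sum mu (S m) 1 (S m)) by lia. rewrite <- Hsum.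
    apply sum_n_m_ext. intros i. unfold mu.
    rewrite Rabs_mult, (Rabs_pos_eq (rho ^ i)) by (apply pow_le; lra). apply Rmult_comm. }
  (* [g] is the series [z h] at angle 0, the rescaled inverse return map. *)
  set (g := PS_incr_1 (jh (jet_lim mu m) 0)).
  assert (Bg : bounded_by g (5 / 3 / 2)).
  { apply bounded_by_incr. pose proof PI_RGT_0.
    apply (jet_lim_bounded mu m 0 Hab). apply Boule_time. lra. }
  assert (Hinv_eq : forall x, Rabs x < Rmin eps (rho / 2) ->
    inv x = rho * PSeries g (x / rho)).
  { intros x Hx.
    assert (Hx1 : Rabs x < eps) by (eapply Rlt_le_trans; [exact Hx | apply Rmin_l]).
    assert (Hx2 : Rabs x < rho / 2) by (eapply Rlt_le_trans; [exact Hx | apply Rmin_r]).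
    assert (Hxr : Rabs (x / rho) < / 2).
    { rewrite Rabs_div, (Rabs_pos_eq rho) by lra.
      apply Rmult_lt_reg_r with rho; [exact Hrho |].
      replace (Rabs x / rho * rho) with (Rabs x) by (field; lra). lra. }
    destruct (Hinv x Hx1) as [Hi1 Hi2]. destruct (Hsol (inv x) Hi1) as [H0 HD].
    assert (Hg : PSeries g (x / rho) = flow mu m 0 (x / rho)) by apply PSeries_incr_1.
    rewrite Hg, <- H0.
    pose proof PI_RGT_0 as Hpi.
    (* Both solutions take the value [x] at [2 * PI]; uniqueness backwards in the angle compares
       them at 0. *)
    apply (polar_unique (S m) lam (fun t => sol t (inv x)) (fun t => rho * flow mu m t (x / rho))
      0 (2 * PI)); [lra | |].
    - intros t Ht. split; [apply HD; lra |].
      apply (is_derive_rescale (S m) lam rho (fun t => flow mu m t (x / rho))).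
      apply flow_solution; trivial.
      apply Boule_time. lra.
    - rewrite Hi2, flow_2PI by trivial. field. lra. }
  assert (Hg0 : forall k, Rabs (g k) <= 2 ^ k).
  { intros k. pose proof (bounded_by_coef g _ k Bg) as H.
    apply Rmult_le_reg_r with ((/ 2) ^ k); [apply half_pow_pos |].
    rewrite <- Rpow_mult_distr, Rinv_r, pow1 by lra. lra. }
  (* The coefficients of [x |-> rho * g (x / rho)]. *)
  set (c := fun k => rho * g k / rho ^ k).
  assert (Hpr : forall k, 0 < rho ^ k) by (intros k; now apply pow_lt).
  assert (Hc : forall k, taylor_coef inv k = c k).
  { intros k. unfold taylor_coef.
    (* [inv] coincides with the sum of this series near 0, so their derivatives at 0 are equal. *)
    rewrite (Derive_n_ext_loc inv (PSeries c)).
    - rewrite Derive_n_coef.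
      + field. apply INR_fact_neq_0.
      + apply Rbar_lt_le_trans with (rho / 2); [simpl; lra |].
        apply CV_radius_bounded. exists rho. intros n. unfold c.
        replace (rho * g n / rho ^ n * (rho / 2) ^ n) with (rho * (g n * (/ 2) ^ n)).
        2: { unfold Rdiv. rewrite Rpow_mult_distr. field. apply Rgt_not_eq, Hpr. }
        rewrite !Rabs_mult, (Rabs_pos_eq rho), (Rabs_pos_eq ((/ 2) ^ n))
          by (apply Rlt_le; (exact Hrho || apply half_pow_pos)).
        pose proof (bounded_by_coef g _ n Bg). nra.
    - assert (Hm : 0 < Rmin eps (rho / 2)) by (apply Rmin_pos; lra).
      exists (mkposreal _ Hm). intros x Hx.
      change (Rabs (x - 0) < Rmin eps (rho / 2)) in Hx. rewrite Rminus_0_r in Hx.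
      rewrite (Hinv_eq x Hx). unfold PSeries. rewrite <- Series_scal_l.
      apply Series_ext. intros n. unfold c, Rdiv.
      rewrite Rpow_mult_distr, pow_inv. ring. }
  (* Since [|g k| <= 2 ^ k], a geometric series of ratio [2 |z| / rho < 1] majorises the complex
     terms. *)
  apply (ex_series_le (V := C_CompleteNormedModule) _
    (fun k => rho * (2 * (Cmod z / rho)) ^ k)).
  - intros k. change (Cmod (Cmult (RtoC (taylor_coef inv k)) (pow_n z k))
      <= rho * (2 * (Cmod z / rho)) ^ k).
    assert (Hzk : Cmod (pow_n z k) = Cmod z ^ k).
    { induction k as [|k IH]; [apply Cmod_1 |].
      change (Cmod (Cmult z (pow_n z k)) = Cmod z * Cmod z ^ k).
      now rewrite Cmod_mult, IH. }
    rewrite Cmod_mult, Cmod_R, Hc, Hzk. unfold c, Rdiv.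
    rewrite !Rabs_mult, (Rabs_pos_eq rho), (Rabs_pos_eq (/ rho ^ k)).
    2: apply Rlt_le, Rinv_0_lt_compat, Hpr. 2: lra.
    rewrite !Rpow_mult_distr, pow_inv.
    replace (rho * Rabs (g k) * / rho ^ k * Cmod z ^ k)
      with (Rabs (g k) * (rho * (Cmod z ^ k * / rho ^ k))) by ring.
    replace (rho * (2 ^ k * (Cmod z ^ k * / rho ^ k)))
      with (2 ^ k * (rho * (Cmod z ^ k * / rho ^ k))) by ring.
    apply Rmult_le_compat_r; [| apply Hg0].
    apply Rmult_le_pos; [lra |]. apply Rmult_le_pos.
    + apply pow_le, Cmod_ge_0.
    + apply Rlt_le, Rinv_0_lt_compat, Hpr.
  - apply (ex_series_scal (V := R_NormedModule) rho (fun k => (2 * (Cmod z / rho)) ^ k)). apply ex_series_geom.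
    pose proof (Cmod_ge_0 z).
    assert (0 <= Cmod z / rho < / 2).
    { split; [apply Rdiv_le_0_compat; lra |].
      apply Rmult_lt_reg_r with rho; [exact Hrho |].
      replace (Cmod z / rho * rho) with (Cmod z) by (field; lra). lra. }
    rewrite Rabs_pos_eq; lra.
Qed.
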